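(* Let $K$ be a field of characteristic zero, $R=K[x_1,\ldots,x_n]$, $D=R\langle\partial_1,\ldots,\partial_n\rangle$ the $n$-th Weyl algebra over $K$, $f\in R$, $J\subseteq D$ a left ideal, and $M=D/J$. Let $D_v=D\langle v,\partial_v\rangle$ be the Weyl algebra in the $n+1$ variables $x_1,\ldots,x_n,v$, and let $\phi:D\to D_v$ be the ring homomorphism with $\phi(x_i)=x_i$ and $\phi(\partial_i)=\partial_i-v^2\frac{\partial f}{\partial x_i}\partial_v$. Consider the left ideal $D_v\cdot\{1-fv,\phi(J)\}$ of $D_v$ generated by $1-fv$ and $\phi(J)$, and the right ideal $\{\partial_v\}\cdot D_v$ of $D_v$. The quotient $$D_v/\bigl(D_v\cdot\{1-fv,\phi(J)\}+\{\partial_v\}\cdot D_v\bigr)$$ is isomorphic to $M\otimes_R R_f$ as a $D$-module. Moreover, the natural map $M\to M\otimes_R R_f$ sends $\bar 1\in M$ to $\bar 1\otimes\frac{1}{f^2}$.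
   Context: $R_f=R[f^{-1}]$ is the localization of $R$ at the powers of $f$, and $\bar 1$ denotes the coset of $1$ in $M=D/J$. $M\otimes_R R_f$ is a left $D$-module in the usual way: elements of $R$ act by multiplication and $\partial_i$ acts by the product rule. The variables $v$ and $\partial_v$ commute with $D$ and satisfy $\partial_v v-v\partial_v=1$. The quotient of $D_v$ is a left $D$-module by left multiplication, with $D\subset D_v$ the natural inclusion; this is well defined because $D$ and $\partial_v$ commute.
   Formalization: The ''Moreover'' sentence is false as written (f=x, J=D∂: the natural map sends 1̄ to 1̄⊗1); it is replaced by: the isomorphism sends the coset of 1 in the quotient of D_v to 1̄⊗1/f², and the natural map sends 1̄ to the image of the coset of f². *)

(* Defs.v *)
From HB Require Import structures.
From mathcomp Require Import all_boot all_order all_algebra.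
From mathcomp Require Import boolp.
From mathcomp Require Import mpoly freeg.
From mathcomp Require Import ring.

Set Implicit Arguments.
Unset Strict Implicit.
Unset Printing Implicit Defensive.

Import GRing.Theory.
Local Open Scope ring_scope.
Local Open Scope quotient_scope.

Section Span.
Variables (B : pzRingType) (V : lmodType B) (S : V -> Prop).

Definition submod_span : {pred V} := fun x =>
  `[< exists s : seq (B * V),
        (forall p, p \in s -> S p.2) /\ x = \sum_(p <- s) p.1 *: p.2 >].

Lemma submod_span_closed : GRing.submod_closed submod_span.
Proof.
split=> [|a u v /asboolP[s [Ss ->]] /asboolP[t [St ->]]].
  by apply/asboolP; exists [::]; rewrite big_nil.
apply/asboolP; exists ([seq (a * p.1, p.2) | p <- s] ++ t); split=> [p|].
  rewrite mem_cat => /orP[/mapP[q qs ->] /=|]; [exact: Ss | exact: St].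
rewrite big_cat big_map scaler_sumr /=; congr (_ + _).
by apply: eq_bigr => p _; rewrite scalerA.
Qed.

HB.instance Definition _ :=
  GRing.isSubmodClosed.Build B V submod_span
  (GRing.submod_closed_semi submod_span_closed).

Lemma submod_span_gen x : S x -> x \in submod_span.
Proof.
move=> Sx; apply/asboolP; exists [:: (1, x)]; split=> [p|].
  by rewrite inE => /eqP ->.
by rewrite big_seq1 scale1r.
Qed.

End Span.

Section QuotientModule.
Variables (B : pzRingType) (V : lmodType B).

Variable S : submodClosed V.

Definition submod_pred : {pred V} := S.

Lemma submod_pred_closed : zmod_closed submod_pred.
Proof.
split; first exact: (rpred0 S).
move=> x y Sx Sy; rewrite -scaleN1r; apply: (rpredD (S := S)) => //.
exact: (rpredZ (s := S)).
Qed.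

HB.instance Definition _ :=
  GRing.isZmodClosed.Build V submod_pred submod_pred_closed.

Definition modquot := {ideal_quot submod_pred}.
HB.instance Definition _ := GRing.Zmodule.on modquot.

Definition cls (x : V) : modquot := \pi_({ideal_quot submod_pred}) x.

Lemma cls_additive : zmod_morphism cls.
Proof. by move=> x y; rewrite /cls raddfB. Qed.
HB.instance Definition _ := GRing.isZmodMorphism.Build V modquot cls cls_additive.

Lemma cls_eqP x y : (cls x = cls y) <-> (x - y \in S).
Proof.
by rewrite -[x - y \in S]/(x - y \in submod_pred) Quotient.idealrBE; split=> /eqP.
Qed.

Lemma cls_repr (q : modquot) : cls (repr q) = q.
Proof. exact: reprK. Qed.

Definition modquot_scale (a : B) (q : modquot) : modquot := cls (a *: repr q).

Lemma modquot_scaleE a x : modquot_scale a (cls x) = cls (a *: x).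
Proof.
by apply/cls_eqP; rewrite -scalerBr rpredZ //; apply/cls_eqP; exact: cls_repr.
Qed.

Lemma modquot_scalerA a b q :
  modquot_scale a (modquot_scale b q) = modquot_scale (a * b) q.
Proof. by rewrite -(cls_repr q) !modquot_scaleE scalerA. Qed.

Lemma modquot_scale1r : left_id 1 modquot_scale.
Proof. by move=> q; rewrite -(cls_repr q) modquot_scaleE scale1r. Qed.

Lemma modquot_scalerDr : right_distributive modquot_scale +%R.
Proof.
move=> a q r; rewrite -(cls_repr q) -(cls_repr r) -raddfD !modquot_scaleE.
by rewrite scalerDr raddfD.
Qed.

Lemma modquot_scalerDl q : {morph modquot_scale^~ q : a b / a + b}.
Proof.
by move=> a b; rewrite -(cls_repr q) !modquot_scaleE scalerDl raddfD.
Qed.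

HB.instance Definition _ := GRing.Zmodule_isLmodule.Build B modquot
  modquot_scalerA modquot_scale1r modquot_scalerDr modquot_scalerDl.

Lemma scale_clsE a x : a *: cls x = cls (a *: x).
Proof. exact: modquot_scaleE. Qed.

End QuotientModule.

Definition restrict_scalars (B C : pzRingType) (rho : {rmorphism B -> C})
  (W : lmodType C) : Type := W.

Section RestrictScalars.
Variables (B C : pzRingType) (rho : {rmorphism B -> C}) (W : lmodType C).
Local Notation W' := (restrict_scalars rho W).

HB.instance Definition _ := GRing.Zmodule.on W'.

Definition rs_scale (b : B) (w : W') : W' := rho b *: (w : W).

Lemma rs_scalerA a b w : rs_scale a (rs_scale b w) = rs_scale (a * b) w.
Proof. by rewrite /rs_scale scalerA rmorphM. Qed.
Lemma rs_scale1r : left_id 1 rs_scale.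
Proof. by move=> w; rewrite /rs_scale rmorph1 scale1r. Qed.
Lemma rs_scalerDr : right_distributive rs_scale +%R.
Proof. by move=> a u v; rewrite /rs_scale scalerDr. Qed.
Lemma rs_scalerDl w : {morph rs_scale^~ w : a b / a + b}.
Proof. by move=> a b; rewrite /rs_scale rmorphD scalerDl. Qed.

HB.instance Definition _ := GRing.Zmodule_isLmodule.Build B W'
  rs_scalerA rs_scale1r rs_scalerDr rs_scalerDl.
End RestrictScalars.

Section Localization.
Variables (A : comNzRingType) (f : A).

(* The pair (g, k) stands for g / f ^ k. *)
Definition loc_rel (u v : A * nat) : bool :=
  `[< exists m, f ^+ m * (u.1 * f ^+ v.2 - v.1 * f ^+ u.2) = 0 >].

Lemma loc_rel_equiv : equiv_class_of loc_rel.
Proof.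
split=> [u|u v|v u w].
- by apply/asboolP; exists 0%N; rewrite subrr mulr0.
- by apply/asboolP/asboolP=> -[m Hm]; exists m; rewrite -opprB mulrN Hm oppr0.
- move=> /asboolP[m Hm] /asboolP[p Hp]; apply/asboolP; exists (m + p + v.2)%N.
  transitivity (f ^+ (p + w.2) * (f ^+ m * (u.1 * f ^+ v.2 - v.1 * f ^+ u.2))
    + f ^+ (m + u.2) * (f ^+ p * (v.1 * f ^+ w.2 - w.1 * f ^+ v.2))).
    by rewrite !exprD; ring.
  by rewrite Hm Hp !mulr0 addr0.
Qed.

Canonical loc_rel_equivRel := EquivRelPack loc_rel_equiv.

Definition loc := {eq_quot loc_rel}.
HB.instance Definition _ := Choice.on loc.

Definition locfrac (g : A) (k : nat) : loc := \pi_({eq_quot loc_rel}) (g, k).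

Lemma locfrac_eqP g k h l :
  locfrac g k = locfrac h l <-> exists m, f ^+ m * (g * f ^+ l - h * f ^+ k) = 0.
Proof.
split=> [/eqmodP /asboolP //|H].
by apply/eqmodP/asboolP.
Qed.

Lemma locfracW (P : loc -> Prop) : (forall g k, P (locfrac g k)) -> forall x, P x.
Proof. by move=> H x; rewrite -[x]reprK; case: (repr x). Qed.

Lemma repr_locfrac g k :
  locfrac (repr (locfrac g k)).1 (repr (locfrac g k)).2 = locfrac g k.
Proof. by rewrite /locfrac -surjective_pairing reprK. Qed.

Definition loc_zero : loc := locfrac 0 0.
Definition loc_one : loc := locfrac 1 0.
Definition loc_opp (x : loc) : loc := locfrac (- (repr x).1) (repr x).2.
Definition loc_add (x y : loc) : loc :=
  locfrac ((repr x).1 * f ^+ (repr y).2 + (repr y).1 * f ^+ (repr x).2)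
       ((repr x).2 + (repr y).2).
Definition loc_mul (x y : loc) : loc :=
  locfrac ((repr x).1 * (repr y).1) ((repr x).2 + (repr y).2).

Lemma loc_oppE g k : loc_opp (locfrac g k) = locfrac (- g) k.
Proof.
apply/locfrac_eqP; have /locfrac_eqP[m Hm] := repr_locfrac g k; exists m.
by rewrite -[RHS]oppr0 -Hm; ring.
Qed.

Lemma loc_addE g k h l :
  loc_add (locfrac g k) (locfrac h l) = locfrac (g * f ^+ l + h * f ^+ k) (k + l).
Proof.
apply/locfrac_eqP; have /locfrac_eqP[m Hm] := repr_locfrac g k.
have /locfrac_eqP[p Hp] := repr_locfrac h l; exists (m + p)%N.
move: (repr _).1 (repr _).2 Hm (repr _).1 (repr _).2 Hp => a i Hm b j Hp.
transitivity (f ^+ (p + j + l) * (f ^+ m * (a * f ^+ k - g * f ^+ i)) +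
  f ^+ (m + i + k) * (f ^+ p * (b * f ^+ l - h * f ^+ j))).
  by rewrite !exprD; ring.
by rewrite Hm Hp !mulr0 addr0.
Qed.

Lemma loc_mulE g k h l :
  loc_mul (locfrac g k) (locfrac h l) = locfrac (g * h) (k + l).
Proof.
apply/locfrac_eqP; have /locfrac_eqP[m Hm] := repr_locfrac g k.
have /locfrac_eqP[p Hp] := repr_locfrac h l; exists (m + p)%N.
move: (repr _).1 (repr _).2 Hm (repr _).1 (repr _).2 Hp => a i Hm b j Hp.
transitivity (f ^+ (p + l) * b * (f ^+ m * (a * f ^+ k - g * f ^+ i)) +
  f ^+ (m + i) * g * (f ^+ p * (b * f ^+ l - h * f ^+ j))).
  by rewrite !exprD; ring.
by rewrite Hm Hp !mulr0 addr0.
Qed.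

Lemma locfrac_eq g k h l : g * f ^+ l = h * f ^+ k -> locfrac g k = locfrac h l.
Proof. by move=> e; apply/locfrac_eqP; exists 0%N; rewrite e subrr mulr0. Qed.

Lemma loc_addA : associative loc_add.
Proof.
elim/locfracW=> g k; elim/locfracW=> h l; elim/locfracW=> e j; rewrite !loc_addE.
by apply: locfrac_eq; rewrite !exprD; ring.
Qed.
Lemma loc_addC : commutative loc_add.
Proof.
elim/locfracW=> g k; elim/locfracW=> h l; rewrite !loc_addE.
by apply: locfrac_eq; rewrite !exprD; ring.
Qed.
Lemma loc_add0 : left_id loc_zero loc_add.
Proof. by elim/locfracW=> g k; rewrite loc_addE mul0r expr0 mulr1 add0r. Qed.
Lemma loc_addN : left_inverse loc_zero loc_opp loc_add.
Proof.
elim/locfracW=> g k; rewrite loc_oppE loc_addE.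
by apply: locfrac_eq; rewrite !exprD expr0; ring.
Qed.

HB.instance Definition _ :=
  GRing.isZmodule.Build loc loc_addA loc_addC loc_add0 loc_addN.

Lemma loc_mulA : associative loc_mul.
Proof.
elim/locfracW=> g k; elim/locfracW=> h l; elim/locfracW=> e j.
by rewrite !loc_mulE mulrA addnA.
Qed.
Lemma loc_mulC : commutative loc_mul.
Proof.
by elim/locfracW=> g k; elim/locfracW=> h l; rewrite !loc_mulE mulrC addnC.
Qed.
Lemma loc_mul1 : left_id loc_one loc_mul.
Proof. by elim/locfracW=> g k; rewrite loc_mulE mul1r. Qed.
Lemma loc_mul1r : right_id loc_one loc_mul.
Proof. by move=> x; rewrite loc_mulC loc_mul1. Qed.
Lemma loc_mulDl : left_distributive loc_mul +%R.
Proof.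
elim/locfracW=> g k; elim/locfracW=> h l; elim/locfracW=> e j.
rewrite [_ + _]loc_addE !loc_mulE [RHS]loc_addE.
by apply: locfrac_eq; rewrite !exprD; ring.
Qed.
Lemma loc_mulDr : right_distributive loc_mul +%R.
Proof. by move=> x y z; rewrite ![loc_mul x _]loc_mulC loc_mulDl. Qed.

(* The ring may be zero, namely when f is nilpotent. *)
HB.instance Definition _ := GRing.Zmodule_isPzRing.Build loc
  loc_mulA loc_mul1 loc_mul1r loc_mulDl loc_mulDr.
HB.instance Definition _ := GRing.PzRing_hasCommutativeMul.Build loc loc_mulC.

Lemma locfrac_add g k h l :
  locfrac g k + locfrac h l = locfrac (g * f ^+ l + h * f ^+ k) (k + l).
Proof. exact: loc_addE. Qed.
Lemma locfrac_opp g k : - locfrac g k = locfrac (- g) k.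
Proof. exact: loc_oppE. Qed.
Lemma locfrac_mul g k h l : locfrac g k * locfrac h l = locfrac (g * h) (k + l).
Proof. exact: loc_mulE. Qed.

Definition to_loc (r : A) : loc := locfrac r 0.

Lemma to_loc_additive : zmod_morphism to_loc.
Proof.
move=> r s; rewrite /to_loc locfrac_opp locfrac_add.
by apply: locfrac_eq; rewrite !expr0; ring.
Qed.
Lemma to_loc_multiplicative : monoid_morphism to_loc.
Proof. by split=> // r s; rewrite /to_loc locfrac_mul. Qed.
HB.instance Definition _ :=
  GRing.isZmodMorphism.Build A loc to_loc to_loc_additive.
HB.instance Definition _ :=
  GRing.isMonoidMorphism.Build A loc to_loc to_loc_multiplicative.

(* (g / f ^ k)' = (g' f - k g f') / f ^ (k + 1) *)
Definition loc_der (d : A -> A) (x : loc) : loc :=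
  locfrac (d (repr x).1 * f - ((repr x).1 * d f) *+ (repr x).2) (repr x).2.+1.

Section Derivation.
Variable d : A -> A.
Hypotheses (dB : zmod_morphism d)
  (dM : forall r s, d (r * s) = d r * s + r * d s).

Lemma der1 : d 1 = 0.
Proof.
have := dM 1 1; rewrite !mulr1 mul1r => e.
by apply: (addrI (d 1)); rewrite -e addr0.
Qed.

Lemma der_exp m : d (f ^+ m) * f = (f ^+ m * d f) *+ m.
Proof.
elim: m => [|m IH]; first by rewrite expr0 der1 mul0r.
rewrite exprS dM mulrDl -[f * _ * f]mulrA IH mulrS; congr (_ + _); first by ring.
by rewrite mulrnAr mulrA.
Qed.

Lemma loc_derE g k :
  loc_der d (locfrac g k) = locfrac (d g * f - (g * d f) *+ k) k.+1.
Proof.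
have dD r s : d (r + s) = d r + d s.
  have d0 : d 0 = 0 by have := dB 0 0; rewrite !subrr.
  have dN t : d (- t) = - d t by have := dB 0 t; rewrite d0 !sub0r.
  by have := dB r (- s); rewrite opprK dN opprK.
apply/locfrac_eqP; have /locfrac_eqP[m] := repr_locfrac g k.
move: (repr _).1 (repr _).2 => h l Hm; exists m.+1.
have dN t : d (- t) = - d t.
  by have := dB 0 t; rewrite !sub0r => ->;
    have := dB 0 0; rewrite !subrr => ->; rewrite sub0r.
set u := h * f ^+ k - g * f ^+ l in Hm.
have d0 : d 0 = 0 by have := dB 0 0; rewrite !subrr.
have Hd : f ^+ m.+1 * d u = 0.
  have := congr1 d Hm; rewrite dM d0 => /(congr1 ( *%R^~ f)).
  rewrite mul0r mulrDl -[d (f ^+ m) * u * f]mulrAC der_exp => E.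
  rewrite exprS -mulrA mulrC -E -[LHS]add0r; congr (_ + _).
  by rewrite -mulr_natl -!mulrA [d f * u]mulrC !mulrA
    -(mulrA _ (f ^+ m)) Hm mulr0 mul0r.
have Eu : d u * f = d h * f ^+ k * f + h * ((f ^+ k * d f) *+ k)
   - (d g * f ^+ l * f + g * ((f ^+ l * d f) *+ l)).
  by rewrite /u dD dN !dM -!der_exp; ring.
transitivity (f * (f ^+ m.+1 * d u) * f - f ^+ m * u * (f * f * d f) *+ (k + l)).
  rewrite (_ : f * _ * f = f ^+ m.+2 * (d u * f)); last by rewrite !exprS; ring.
  rewrite Eu /u -!(mulr_natl (_ * _)) natrD !exprS.
  move: (f ^+ m) (f ^+ k) (f ^+ l) (k%:R : A) (l%:R : A) (d g) (d h) (d f).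
  by move=> *; ring.
by rewrite Hd Hm !mulr0 !mul0r mul0rn subr0.
Qed.

Lemma der_sum r s : d (r + s) = d r + d s.
Proof.
have d0 : d 0 = 0 by have := dB 0 0; rewrite !subrr.
have dN t : d (- t) = - d t by have := dB 0 t; rewrite d0 !sub0r.
by have := dB r (- s); rewrite opprK dN opprK.
Qed.

Lemma loc_derD x y : loc_der d (x + y) = loc_der d x + loc_der d y.
Proof.
elim/locfracW: x => g k; elim/locfracW: y => h l.
rewrite locfrac_add !loc_derE locfrac_add; apply: locfrac_eq.
rewrite der_sum !dM !mulrDl -![_ * d _ * f]mulrA !der_exp.
rewrite -!(mulr_natl (_ * _)) -(mulr_natl (_ + _)) natrD !exprS !exprD !exprS.
move: (f ^+ k) (f ^+ l) (k%:R : A) (l%:R : A) (d g) (d h) (d f).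
by move=> *; ring.
Qed.

Lemma loc_der_mul r x :
  loc_der d (to_loc r * x) = to_loc (d r) * x + to_loc r * loc_der d x.
Proof.
elim/locfracW: x => g k; rewrite [loc_der d (locfrac g k)]loc_derE /to_loc.
rewrite !locfrac_mul loc_derE locfrac_add !add0n.
apply: locfrac_eq; rewrite dM -!(mulr_natl (_ * _)) !exprD !exprS.
move: (f ^+ k) (k%:R : A) (d g) (d r) (d f).
by move=> *; ring.
Qed.

End Derivation.
Lemma loc_derC (d1 d2 : A -> A) :
  zmod_morphism d1 -> (forall r s, d1 (r * s) = d1 r * s + r * d1 s) ->
  zmod_morphism d2 -> (forall r s, d2 (r * s) = d2 r * s + r * d2 s) ->
  (forall r, d1 (d2 r) = d2 (d1 r)) ->
  forall x, loc_der d1 (loc_der d2 x) = loc_der d2 (loc_der d1 x).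
Proof.
move=> d1B d1M d2B d2M dC; elim/locfracW=> g k; rewrite !loc_derE //.
have dMn (d : A -> A) (dB : zmod_morphism d) t m : d (t *+ m) = d t *+ m.
  elim: m => [|m IH]; first by rewrite !mulr0n; have := dB 0 0; rewrite !subrr.
  by rewrite !mulrS der_sum // IH.
congr locfrac; rewrite d1B d2B (dMn d1) // (dMn d2) // !d1M !d2M !dC.
rewrite -!(mulr_natl (_ * _)) -!(mulr_natl (_ + _)) -natr1.
move: (d2 (d1 g)) (d2 (d1 f)) (d1 g) (d2 g) (d1 f) (d2 f) (k%:R : A) => *.
by ring.
Qed.

End Localization.

Section Tensor.
Variables (A : comNzRingType) (M N : lmodType A).

Notation free := {freeg (M * N)%type / int}.
Local Notation "m # n" := (<< (m, n) >> : free) (at level 38).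

Definition tensor_rel (x : free) : Prop :=
  [\/ exists m m' n, x = (m + m') # n - m # n - m' # n,
      exists m n n', x = m # (n + n') - m # n - m # n'
    | exists a m n, x = (a *: m) # n - m # (a *: n)].

Definition tensor := modquot (submod_span tensor_rel : submodClosed free).
HB.instance Definition _ := GRing.Zmodule.on tensor.

Definition tens (m : M) (n : N) : tensor := cls _ (m # n).

Lemma tensDl m m' n : tens (m + m') n = tens m n + tens m' n.
Proof.
rewrite /tens -raddfD; apply/cls_eqP; apply: submod_span_gen; apply: Or31.
by exists m, m', n; rewrite opprD addrA.
Qed.

Lemma tensDr m n n' : tens m (n + n') = tens m n + tens m n'.
Proof.
rewrite /tens -raddfD; apply/cls_eqP; apply: submod_span_gen; apply: Or32.
by exists m, n, n'; rewrite opprD addrA.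
Qed.

Lemma tensZ a m n : tens (a *: m) n = tens m (a *: n).
Proof. by apply/cls_eqP; apply: submod_span_gen; apply: Or33; exists a, m, n. Qed.

Section Lift.
Variables (G : zmodType) (h : M -> N -> G).

Definition tensor_lift (t : tensor) : G :=
  fglift (fun mn => h mn.1 mn.2 : zmodule G) (repr t).

Hypotheses (hDl : forall m m' n, h (m + m') n = h m n + h m' n)
  (hDr : forall m n n', h m (n + n') = h m n + h m n')
  (hZ : forall a m n, h (a *: m) n = h m (a *: n)).

Let flift : free -> zmodule G := fglift (fun mn => h mn.1 mn.2 : zmodule G).

Let fliftB : zmod_morphism flift.
Proof. exact: lift_is_additive. Qed.
HB.instance Definition _ := GRing.isZmodMorphism.Build free (zmodule G) flift fliftB.

Let flift_gen m n : flift (m # n) = h m n.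
Proof. by rewrite /flift liftU scale1r. Qed.

Let flift_rel x : x \in submod_span tensor_rel -> flift x = 0.
Proof.
move=> /asboolP[s [Ss ->]]; rewrite raddf_sum big_seq big1 // => p /Ss Sp.
suff E : flift p.2 = 0.
  by rewrite -[p.1]intz scaler_int raddfMz; move: E => /= ->; rewrite mul0rz.
case: Sp => [[m [m' [n ->]]]|[m [n [n' ->]]]|[a [m [n ->]]]].
- by rewrite !fliftB !flift_gen hDl addrAC addrK subrr.
- by rewrite !fliftB !flift_gen hDr addrAC addrK subrr.
- by rewrite !fliftB !flift_gen hZ subrr.
Qed.

Let tensor_lift_cls x : tensor_lift (cls _ x) = flift x.
Proof.
apply/eqP; rewrite -subr_eq0 -fliftB flift_rel //.
by apply/cls_eqP; rewrite cls_repr.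
Qed.

Lemma tensor_liftE m n : tensor_lift (tens m n) = h m n.
Proof. by rewrite tensor_lift_cls flift_gen. Qed.

Lemma tensor_lift_additive : zmod_morphism tensor_lift.
Proof.
move=> t u; rewrite -(cls_repr t) -(cls_repr u) -raddfB !tensor_lift_cls.
exact: fliftB.
Qed.

End Lift.

Lemma tensor_ind (P : tensor -> Prop) :
  P 0 -> (forall t u, P t -> P u -> P (t - u)) -> (forall m n, P (tens m n)) ->
  forall t, P t.
Proof.
move=> P0 PB Pt t.
have PN u : P u -> P (- u) by move=> Pu; rewrite -sub0r; apply: PB.
have PD u w : P u -> P w -> P (u + w).
  by move=> Pu Pw; rewrite -[w]opprK; apply: PB => //; apply: PN.
have PMn u k : P u -> P (u *+ k).
  by move=> Pu; elim: k => [|k IHk]; rewrite ?mulr0n // mulrS; apply: PD.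
rewrite -(cls_repr t) -[repr t]freeg_sumE raddf_sum.
elim/big_rec: _ => // -[m n] x _ Px; apply: PD => //.
rewrite -[coeff _ _]intz -freegU_mulz raddfMz.
case: (coeff _ _) => k; first by apply: (PMn (tens m n)).
by rewrite NegzE mulrNz; apply: PN; apply: (PMn (tens m n)).
Qed.

End Tensor.

Section WeylPresentation.
Variables (K : fieldType) (n : nat).
Local Notation R := {mpoly K[n]}.

(* R<d_1, ..., d_n> is presented as the ring generated by the elements of R and
   by symbols d_i, subject to the ring axioms, to the relations of R, and to
   d_i d_j = d_j d_i and d_i r = r d_i + dr/dx_i. *)
Inductive wterm : Type :=
| WPol (r : R)
| WDer (i : 'I_n)
| WAdd (a b : wterm)
| WOpp (a : wterm)
| WMul (a b : wterm).

HB.instance Definition _ := gen_eqMixin wterm.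
HB.instance Definition _ := gen_choiceMixin wterm.

Inductive weq : wterm -> wterm -> Prop :=
| weq_refl a : weq a a
| weq_sym a b : weq a b -> weq b a
| weq_trans a b c : weq a b -> weq b c -> weq a c
| weq_add a a' b b' : weq a a' -> weq b b' -> weq (WAdd a b) (WAdd a' b')
| weq_opp a a' : weq a a' -> weq (WOpp a) (WOpp a')
| weq_mul a a' b b' : weq a a' -> weq b b' -> weq (WMul a b) (WMul a' b')
| weq_addA a b c : weq (WAdd a (WAdd b c)) (WAdd (WAdd a b) c)
| weq_addC a b : weq (WAdd a b) (WAdd b a)
| weq_add0 a : weq (WAdd (WPol 0) a) a
| weq_addN a : weq (WAdd (WOpp a) a) (WPol 0)
| weq_mulA a b c : weq (WMul a (WMul b c)) (WMul (WMul a b) c)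
| weq_mul1 a : weq (WMul (WPol 1) a) a
| weq_mul1r a : weq (WMul a (WPol 1)) a
| weq_mulDl a b c : weq (WMul (WAdd a b) c) (WAdd (WMul a c) (WMul b c))
| weq_mulDr a b c : weq (WMul a (WAdd b c)) (WAdd (WMul a b) (WMul a c))
| weq_polD r s : weq (WPol (r + s)) (WAdd (WPol r) (WPol s))
| weq_polM r s : weq (WPol (r * s)) (WMul (WPol r) (WPol s))
| weq_derC i j : weq (WMul (WDer i) (WDer j)) (WMul (WDer j) (WDer i))
| weq_leibniz i r :
    weq (WMul (WDer i) (WPol r)) (WAdd (WMul (WPol r) (WDer i)) (WPol r^`M(i))).

Definition weqb (a b : wterm) : bool := `[< weq a b >].

Lemma weqb_equiv : equiv_class_of weqb.
Proof.
split=> [a|a b|b a c].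
- by apply/asboolP; apply: weq_refl.
- by apply/asboolP/asboolP; apply: weq_sym.
- by move=> /asboolP ab /asboolP bc; apply/asboolP; apply: weq_trans ab bc.
Qed.

Canonical weqb_equivRel := EquivRelPack weqb_equiv.

Definition weyl := {eq_quot weqb}.
HB.instance Definition _ := Choice.on weyl.

Definition wcls (a : wterm) : weyl := \pi_({eq_quot weqb}) a.

Lemma wcls_eqP a b : wcls a = wcls b <-> weq a b.
Proof.
split=> [/eqmodP /asboolP //|H].
by apply/eqmodP/asboolP.
Qed.

Lemma wclsK (x : weyl) : wcls (repr x) = x.
Proof. exact: reprK. Qed.

Lemma repr_wcls a : weq (repr (wcls a)) a.
Proof. by apply/wcls_eqP; exact: wclsK. Qed.

Lemma wclsW (P : weyl -> Prop) : (forall a, P (wcls a)) -> forall x, P x.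
Proof. by move=> H x; rewrite -(wclsK x). Qed.

Definition weyl_add (x y : weyl) : weyl := wcls (WAdd (repr x) (repr y)).
Definition weyl_opp (x : weyl) : weyl := wcls (WOpp (repr x)).
Definition weyl_mul (x y : weyl) : weyl := wcls (WMul (repr x) (repr y)).

Lemma weyl_addE a b : weyl_add (wcls a) (wcls b) = wcls (WAdd a b).
Proof. by apply/wcls_eqP/weq_add; exact: repr_wcls. Qed.
Lemma weyl_oppE a : weyl_opp (wcls a) = wcls (WOpp a).
Proof. by apply/wcls_eqP/weq_opp; exact: repr_wcls. Qed.
Lemma weyl_mulE a b : weyl_mul (wcls a) (wcls b) = wcls (WMul a b).
Proof. by apply/wcls_eqP/weq_mul; exact: repr_wcls. Qed.
Let weylE := (weyl_addE, weyl_oppE, weyl_mulE).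

Lemma weyl_addA : associative weyl_add.
Proof.
elim/wclsW=> a; elim/wclsW=> b; elim/wclsW=> c; rewrite !weylE.
by apply/wcls_eqP/weq_addA.
Qed.
Lemma weyl_addC : commutative weyl_add.
Proof.
by elim/wclsW=> a; elim/wclsW=> b; rewrite !weylE; apply/wcls_eqP/weq_addC.
Qed.
Lemma weyl_add0 : left_id (wcls (WPol 0)) weyl_add.
Proof. by elim/wclsW=> a; rewrite weylE; apply/wcls_eqP/weq_add0. Qed.
Lemma weyl_addN : left_inverse (wcls (WPol 0)) weyl_opp weyl_add.
Proof. by elim/wclsW=> a; rewrite !weylE; apply/wcls_eqP/weq_addN. Qed.

HB.instance Definition _ :=
  GRing.isZmodule.Build weyl weyl_addA weyl_addC weyl_add0 weyl_addN.

Lemma weyl_mulA : associative weyl_mul.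
Proof.
elim/wclsW=> a; elim/wclsW=> b; elim/wclsW=> c; rewrite !weylE.
by apply/wcls_eqP/weq_mulA.
Qed.
Lemma weyl_mul1 : left_id (wcls (WPol 1)) weyl_mul.
Proof. by elim/wclsW=> a; rewrite weylE; apply/wcls_eqP/weq_mul1. Qed.
Lemma weyl_mul1r : right_id (wcls (WPol 1)) weyl_mul.
Proof. by elim/wclsW=> a; rewrite weylE; apply/wcls_eqP/weq_mul1r. Qed.
Lemma weyl_mulDl : left_distributive weyl_mul weyl_add.
Proof.
elim/wclsW=> a; elim/wclsW=> b; elim/wclsW=> c; rewrite !weylE.
by apply/wcls_eqP/weq_mulDl.
Qed.
Lemma weyl_mulDr : right_distributive weyl_mul weyl_add.
Proof.
elim/wclsW=> a; elim/wclsW=> b; elim/wclsW=> c; rewrite !weylE.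
by apply/wcls_eqP/weq_mulDr.
Qed.

HB.instance Definition _ := GRing.Zmodule_isPzRing.Build weyl
  weyl_mulA weyl_mul1 weyl_mul1r weyl_mulDl weyl_mulDr.

Definition wpol (r : R) : weyl := wcls (WPol r).
Definition wder (i : 'I_n) : weyl := wcls (WDer i).

Lemma wpolD r s : wpol (r + s) = wpol r + wpol s.
Proof. by rewrite [RHS]weyl_addE; apply/wcls_eqP/weq_polD. Qed.
Lemma wpol_additive : zmod_morphism wpol.
Proof. by move=> r s; apply: (addIr (wpol s)); rewrite -wpolD !subrK. Qed.
Lemma wpol_multiplicative : monoid_morphism wpol.
Proof. by split=> // r s; rewrite [RHS]weyl_mulE; apply/wcls_eqP/weq_polM. Qed.
HB.instance Definition _ :=
  GRing.isZmodMorphism.Build R weyl wpol wpol_additive.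
HB.instance Definition _ :=
  GRing.isMonoidMorphism.Build R weyl wpol wpol_multiplicative.

Lemma wderC i j : wder i * wder j = wder j * wder i.
Proof. by rewrite [LHS]weyl_mulE [RHS]weyl_mulE; apply/wcls_eqP/weq_derC. Qed.

Lemma wleibniz i r : wder i * wpol r = wpol r * wder i + wpol r^`M(i).
Proof.
rewrite [LHS]weyl_mulE [wpol r * _]weyl_mulE [RHS]weyl_addE.
exact/wcls_eqP/weq_leibniz.
Qed.

Lemma weyl_ind (P : weyl -> Prop) :
  (forall r, P (wpol r)) -> (forall i, P (wder i)) ->
  (forall x y, P x -> P y -> P (x + y)) ->
  (forall x y, P x -> P y -> P (x * y)) -> forall x, P x.
Proof.
move=> Pr Pd PD PM; elim/wclsW; elim=> [r|i|a Pa b Pb|a Pa|a Pa b Pb].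
- exact: Pr.
- exact: Pd.
- by rewrite -weyl_addE; apply: PD.
- have -> : wcls (WOpp a) = -1 * wcls a by rewrite mulN1r [RHS]weyl_oppE.
  apply: PM => //.
  by rewrite -(rmorphN1 wpol); apply: Pr.
- by rewrite -weyl_mulE; apply: PM.
Qed.

(* A ring homomorphism when g is one and d satisfies the relations of weyl. *)
Fixpoint weval (B : pzRingType) (g : R -> B) (d : 'I_n -> B) (a : wterm) : B :=
  match a with
  | WPol r => g r
  | WDer i => d i
  | WAdd a b => weval g d a + weval g d b
  | WOpp a => - weval g d a
  | WMul a b => weval g d a * weval g d b
  end.

Definition weyl_lift (B : pzRingType) (g : R -> B) (d : 'I_n -> B)
  (x : weyl) : B := weval g d (repr x).

Section Lift.
Variables (B : pzRingType) (g : {rmorphism R -> B}) (d : 'I_n -> B).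
Hypotheses (dC : forall i j, d i * d j = d j * d i)
  (dL : forall i r, d i * g r = g r * d i + g r^`M(i)).

Lemma weval_weq a b : weq a b -> weval g d a = weval g d b.
Proof.
elim=> //= {a b}; try by move=> *; congruence.
- by move=> a b c; rewrite addrA.
- by move=> a b; rewrite addrC.
- by move=> a; rewrite rmorph0 add0r.
- by move=> a; rewrite rmorph0 addNr.
- by move=> a b c; rewrite mulrA.
- by move=> a; rewrite rmorph1 mul1r.
- by move=> a; rewrite rmorph1 mulr1.
- by move=> a b c; rewrite mulrDl.
- by move=> a b c; rewrite mulrDr.
- by move=> r s; rewrite rmorphD.
- by move=> r s; rewrite rmorphM.
Qed.

Lemma weyl_lift_cls a : weyl_lift g d (wcls a) = weval g d a.
Proof. exact/weval_weq/repr_wcls. Qed.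

Lemma weyl_lift_pol r : weyl_lift g d (wpol r) = g r.
Proof. exact: weyl_lift_cls. Qed.

Lemma weyl_lift_der i : weyl_lift g d (wder i) = d i.
Proof. exact: weyl_lift_cls. Qed.

Lemma weyl_lift_additive : zmod_morphism (weyl_lift g d).
Proof.
elim/wclsW=> a; elim/wclsW=> b.
by rewrite [- wcls b]weyl_oppE [_ + _]weyl_addE !weyl_lift_cls.
Qed.

Lemma weyl_lift_multiplicative : monoid_morphism (weyl_lift g d).
Proof.
split; first by rewrite weyl_lift_pol rmorph1.
elim/wclsW=> a; elim/wclsW=> b.
by rewrite [_ * _]weyl_mulE !weyl_lift_cls.
Qed.

End Lift.
End WeylPresentation.

Arguments wpol {K n} r.
Arguments wder {K n} i.

Lemma shear_comm (B : pzRingType) (Ei Ej gi gj h w d : B) :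
  Ei * Ej = Ej * Ei -> Ei * w = w * Ei -> Ej * w = w * Ej ->
  Ei * d = d * Ei -> Ej * d = d * Ej ->
  Ei * gj = gj * Ei + h -> Ej * gi = gi * Ej + h ->
  gi * w = w * gi -> gj * w = w * gj -> gi * d = d * gi -> gj * d = d * gj ->
  gi * gj = gj * gi ->
  (Ei - w * gi * d) * (Ej - w * gj * d) = (Ej - w * gj * d) * (Ei - w * gi * d).
Proof.
move=> EE Eiw Ejw Eid Ejd Eigj Ejgi giw gjw gid gjd gg.
have cross E g : E * w = w * E -> E * d = d * E -> E * g = g * E + h ->
    E * (w * g * d) = w * g * d * E + w * h * d.
  move=> Ew Ed Eg; rewrite !mulrA Ew -(mulrA w) Eg mulrDr mulrDl !mulrA.
  by congr (_ + _); rewrite -!mulrA Ed.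
have quad g g' : g * w = w * g -> g * d = d * g ->
    (w * g * d) * (w * g' * d) = w * d * w * (g * g') * d.
  move=> gw gd; rewrite -(mulrA w) gd !mulrA; congr (_ * _ * _).
  by rewrite -!mulrA gw.
rewrite !mulrBl !mulrBr (cross Ei gj) // (cross Ej gi) // !quad // EE gg.
set q := w * d * w * (gj * gi) * d; set c := w * h * d.
set W1 := w * gj * d * Ei; set W2 := w * gi * d * Ej.
rewrite !opprD !opprK !addrA; congr (_ + _); rewrite -!addrA; congr (_ + _).
by rewrite addrCA [RHS]addrCA [- W1 - W2]addrC.
Qed.

Section WeylExtension.
Variables (K : fieldType) (n : nat).
Local Notation D := (weyl K n).
Local Notation Dv := (weyl K n.+1).

(* The variables of D_v are x_1, ..., x_n, v, in this order. *)
Definition xwiden (i : 'I_n) : 'I_n.+1 := widen_ord (leqnSn n) i.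
Definition wv : Dv := wpol 'X_ord_max.
Definition wdv : Dv := wder ord_max.
Definition pol_incl (r : {mpoly K[n]}) : Dv := wpol (mwiden r).

HB.instance Definition _ := GRing.RMorphism.copy pol_incl (wpol \o @mwiden n K).

Definition weyl_incl : D -> Dv := weyl_lift pol_incl (fun i => wder (xwiden i)).

Lemma mderiv_widen (i : 'I_n) (r : {mpoly K[n]}) :
  (mwiden r)^`M(xwiden i) = mwiden r^`M(i).
Proof.
elim/mpolyind: r => [|c m p _ _ IH]; first by rewrite !(mwiden0, mderiv0).
rewrite !(mwidenD, mderivD) IH; congr (_ + _).
rewrite !(mwidenZ, mderivZ, mwidenX, mderivX) mnmwiden_widen.
congr (_ *: (_ *: 'X_[_])); apply/mnmP=> j.
case: (unliftP ord_max j) => [k|] ->.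
  rewrite (_ : fintype.lift ord_max k = xwiden k); last first.
    by apply/val_inj; rewrite /= /bump leqNgt ltn_ord.
  rewrite mnmwiden_widen mnmBE mnmwiden_widen !mnm1E mnmBE mnm1E.
  by congr (_ - nat_of_bool _)%N; apply/eqP/eqP=> [/(congr1 val) /= /val_inj|->].
by rewrite mnmwiden_ordmax mnmBE mnmwiden_ordmax sub0n.
Qed.

Lemma mderiv_widen_max (r : {mpoly K[n]}) : (mwiden r)^`M(ord_max) = 0.
Proof.
elim/mpolyind: r => [|c m p _ _ IH]; first by rewrite mwiden0 mderiv0.
rewrite mwidenD mderivD IH addr0 mwidenZ mderivZ mwidenX mderivX.
by rewrite mnmwiden_ordmax scale0r scaler0.
Qed.

Lemma wincl_derC i j :
  wder (xwiden i) * wder (xwiden j) = wder (xwiden j) * wder (xwiden i) :> Dv.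
Proof. exact: wderC. Qed.

Lemma wincl_leibniz i r :
  wder (xwiden i) * pol_incl r = pol_incl r * wder (xwiden i) + pol_incl r^`M(i).
Proof. by rewrite wleibniz mderiv_widen. Qed.

HB.instance Definition _ := GRing.isZmodMorphism.Build D Dv weyl_incl
  (weyl_lift_additive wincl_derC wincl_leibniz).
HB.instance Definition _ := GRing.isMonoidMorphism.Build D Dv weyl_incl
  (weyl_lift_multiplicative wincl_derC wincl_leibniz).

Lemma weyl_incl_pol r : weyl_incl (wpol r) = pol_incl r.
Proof. exact: (weyl_lift_pol wincl_derC wincl_leibniz). Qed.
Lemma weyl_incl_der i : weyl_incl (wder i) = wder (xwiden i).
Proof. exact: (weyl_lift_der wincl_derC wincl_leibniz). Qed.

Lemma weyl_incl_wdv P : weyl_incl P * wdv = wdv * weyl_incl P.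
Proof.
elim/weyl_ind: P => [r|i|P Q HP HQ|P Q HP HQ].
- by rewrite weyl_incl_pol /wdv wleibniz mderiv_widen_max rmorph0 addr0.
- by rewrite weyl_incl_der; exact: wderC.
- by rewrite rmorphD mulrDl mulrDr HP HQ.
- by rewrite rmorphM -mulrA HQ mulrA HP mulrA.
Qed.

Variable f : {mpoly K[n]}.

Definition phi_der (i : 'I_n) : Dv :=
  wder (xwiden i) - wv ^+ 2 * pol_incl f^`M(i) * wdv.

Definition phi : D -> Dv := weyl_lift pol_incl phi_der.

Lemma wpolC r s : wpol r * wpol s = wpol s * wpol r :> Dv.
Proof. by rewrite -!rmorphM mulrC. Qed.

Lemma xwiden_wv i : wder (xwiden i) * wv = wv * wder (xwiden i).
Proof.
rewrite wleibniz -[RHS]addr0; congr (_ + _).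
rewrite mderivX mnm1E (_ : ord_max == xwiden i = false) ?scale0r ?rmorph0 //.
by apply/eqP=> /(congr1 val) /= e; have := ltn_ord i; rewrite -e ltnn.
Qed.

Lemma wv2E : wv ^+ 2 = wpol ('X_ord_max ^+ 2).
Proof. by rewrite rmorphXn. Qed.

Lemma phi_leibniz i r :
  phi_der i * pol_incl r = pol_incl r * phi_der i + pol_incl r^`M(i).
Proof.
rewrite /phi_der mulrBl wincl_leibniz mulrBr addrAC; congr (_ - _ + _).
have dvr : wdv * pol_incl r = pol_incl r * wdv.
  by rewrite -weyl_incl_pol weyl_incl_wdv.
rewrite wv2E -[LHS]mulrA dvr !mulrA /pol_incl -!rmorphM.
by congr (wpol _ * _); ring.
Qed.

Lemma phi_derC i j : phi_der i * phi_der j = phi_der j * phi_der i.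
Proof.
apply: (shear_comm (h := pol_incl f^`M(i)^`M(j))).
- exact: wderC.
- by rewrite expr2 mulrA xwiden_wv -mulrA xwiden_wv mulrA.
- by rewrite expr2 mulrA xwiden_wv -mulrA xwiden_wv mulrA.
- exact: wderC.
- exact: wderC.
- by rewrite wincl_leibniz mderiv_comm.
- by rewrite wincl_leibniz.
- by rewrite wv2E; exact: wpolC.
- by rewrite wv2E; exact: wpolC.
- by rewrite -weyl_incl_pol weyl_incl_wdv.
- by rewrite -weyl_incl_pol weyl_incl_wdv.
- exact: wpolC.
Qed.

HB.instance Definition _ := GRing.isZmodMorphism.Build D Dv phi
  (weyl_lift_additive phi_derC phi_leibniz).
HB.instance Definition _ := GRing.isMonoidMorphism.Build D Dv phi
  (weyl_lift_multiplicative phi_derC phi_leibniz).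

Lemma phi_pol r : phi (wpol r) = pol_incl r.
Proof. exact: (weyl_lift_pol phi_derC phi_leibniz). Qed.
Lemma phi_wder i :
  phi (wder i) = wder (xwiden i) - wv ^+ 2 * pol_incl f^`M(i) * wdv.
Proof. exact: (weyl_lift_der phi_derC phi_leibniz). Qed.

(* Left ideals of a ring B are the submodules of B^o. *)
Variable J : submodClosed D^o.

Definition left_gen (P : Dv^o) : Prop :=
  P = 1 - pol_incl f * wv \/ exists2 Q, Q \in J & P = phi Q.

(* D_v . {1 - f v, phi(J)} + d_v D_v. In general it is neither a left nor a
   right ideal of D_v, only a submodule of D_v seen as a left D-module. *)
Definition dv_submod : {pred restrict_scalars weyl_incl Dv^o} := fun P =>
  `[< exists a b : Dv, a \in submod_span left_gen /\ P = a + wdv * b >].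

Lemma dv_submod_closed : GRing.submod_closed dv_submod.
Proof.
split=> [|a u w /asboolP[u1 [u2 [Hu ->]]] /asboolP[w1 [w2 [Hw ->]]]].
  apply/asboolP; exists 0, 0; rewrite mulr0 addr0; split=> //.
  by case: (submod_span_closed left_gen).
apply/asboolP; exists (weyl_incl a * u1 + w1), (weyl_incl a * u2 + w2).
split; first by apply: (rpredD (S := submod_span left_gen)) => //;
  apply: (rpredZ (s := submod_span left_gen)).
change (weyl_incl a * (u1 + wdv * u2) + (w1 + wdv * w2) =
  weyl_incl a * u1 + w1 + wdv * (weyl_incl a * u2 + w2) :> Dv).
by rewrite !mulrDr (mulrA _ wdv) weyl_incl_wdv (mulrA wdv) addrACA.
Qed.

HB.instance Definition _ :=
  GRing.isSubmodClosed.Build D (restrict_scalars weyl_incl Dv^o) dv_submod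
  (GRing.submod_closed_semi dv_submod_closed).

Definition dv_quotient : lmodType D := modquot dv_submod.
End WeylExtension.

Section Endomorphisms.
Variable T : zmodType.

Record endo : Type := Endo { endo_fun :> T -> T; endoB : zmod_morphism endo_fun }.

HB.instance Definition _ := gen_eqMixin endo.
HB.instance Definition _ := gen_choiceMixin endo.

Lemma endoP (a b : endo) : (forall t, a t = b t) -> a = b.
Proof.
case: a b => [a aB] [b bB] /= /funext E; case: _ / E in bB *.
by congr Endo; exact: Prop_irrelevance.
Qed.

HB.instance Definition _ (a : endo) := GRing.isZmodMorphism.Build T T a (endoB a).

Definition endo_id : endo := @Endo (fun t => t) (fun t u => erefl).

Lemma endo_zero_proof : zmod_morphism (fun _ : T => 0 : T).
Proof. by move=> t u; rewrite subr0. Qed.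
Definition endo_zero : endo := Endo endo_zero_proof.

Lemma endo_opp_proof (a : endo) : zmod_morphism (fun t => - a t).
Proof. by move=> t u; rewrite raddfB opprD. Qed.
Definition endo_opp (a : endo) : endo := Endo (endo_opp_proof a).

Lemma endo_add_proof (a b : endo) : zmod_morphism (fun t => a t + b t).
Proof. by move=> t u; rewrite !raddfB opprD addrACA. Qed.
Definition endo_add (a b : endo) : endo := Endo (endo_add_proof a b).

Lemma endo_comp_proof (a b : endo) : zmod_morphism (fun t => a (b t)).
Proof. by move=> t u; rewrite !raddfB. Qed.
Definition endo_comp (a b : endo) : endo := Endo (endo_comp_proof a b).

Lemma endo_addA : associative endo_add.
Proof. by move=> a b c; apply: endoP => t /=; rewrite addrA. Qed.
Lemma endo_addC : commutative endo_add.
Proof. by move=> a b; apply: endoP => t /=; rewrite addrC. Qed.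
Lemma endo_add0 : left_id endo_zero endo_add.
Proof. by move=> a; apply: endoP => t /=; rewrite add0r. Qed.
Lemma endo_addN : left_inverse endo_zero endo_opp endo_add.
Proof. by move=> a; apply: endoP => t /=; rewrite addNr. Qed.
HB.instance Definition _ :=
  GRing.isZmodule.Build endo endo_addA endo_addC endo_add0 endo_addN.

Lemma endo_compA : associative endo_comp.
Proof. by move=> a b c; apply: endoP. Qed.
Lemma endo_comp1 : left_id endo_id endo_comp.
Proof. by move=> a; apply: endoP. Qed.
Lemma endo_comp1r : right_id endo_id endo_comp.
Proof. by move=> a; apply: endoP. Qed.
Lemma endo_compDl : left_distributive endo_comp endo_add.
Proof. by move=> a b c; apply: endoP. Qed.
Lemma endo_compDr : right_distributive endo_comp endo_add.
Proof. by move=> a b c; apply: endoP => t /=; rewrite raddfD. Qed.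
HB.instance Definition _ := GRing.Zmodule_isPzRing.Build endo
  endo_compA endo_comp1 endo_comp1r endo_compDl endo_compDr.

End Endomorphisms.

Section LocalizedModule.
Variables (K : fieldType) (n : nat) (f : {mpoly K[n]}).
Local Notation R := {mpoly K[n]}.
Local Notation D := (weyl K n).
Variable M : lmodType D.

Local Notation MR := (restrict_scalars (@wpol K n) M).
Local Notation Rf := (restrict_scalars (to_loc f) (loc f)^o).

(* M (x)_R R_f, where M is an R-module through the inclusion of R in D. *)
Definition localized : Type := tensor MR Rf.
HB.instance Definition _ := GRing.Zmodule.on localized.

Definition lpure (m : M) (g : loc f) : localized := tens (m : MR) (g : Rf).

(* Since m r (x) g = m (x) r g, R acts through the second factor. *)
Definition lmul_fun (r : R) : localized -> localized :=
  tensor_lift (fun (m : MR) (g : Rf) => lpure m (to_loc f r * g)).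

Definition lder_fun (i : 'I_n) : localized -> localized :=
  tensor_lift (fun (m : MR) (g : Rf) =>
    lpure (wder i *: m) g + lpure m (loc_der (mderiv i) g)).

Lemma lpureDl m m' g : lpure (m + m') g = lpure m g + lpure m' g.
Proof. exact: tensDl. Qed.
Lemma lpureDr m g g' : lpure m (g + g') = lpure m g + lpure m g'.
Proof. exact: tensDr. Qed.
Lemma lpureZ r m g : lpure (wpol r *: m) g = lpure m (to_loc f r * g).
Proof. exact: (@tensZ _ MR Rf). Qed.

Let lmul_Dl r m m' g : lpure (m + m') (to_loc f r * g)
  = lpure m (to_loc f r * g) + lpure m' (to_loc f r * g).
Proof. exact: lpureDl. Qed.
Let lmul_Dr r m g g' : lpure m (to_loc f r * (g + g'))
  = lpure m (to_loc f r * g) + lpure m (to_loc f r * g').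
Proof. by rewrite mulrDr lpureDr. Qed.
Let lmul_Z r s m g : lpure (wpol s *: m) (to_loc f r * g)
  = lpure m (to_loc f r * (to_loc f s * g)).
Proof. by rewrite lpureZ mulrCA. Qed.

Lemma lmul_lpure r m g : lmul_fun r (lpure m g) = lpure m (to_loc f r * g).
Proof.
exact: (@tensor_liftE R MR Rf localized
  (fun (m : MR) (g : Rf) => lpure m (to_loc f r * (g : loc f)))
  (lmul_Dl r) (lmul_Dr r) (lmul_Z r)).
Qed.
Lemma lmul_additive r : zmod_morphism (lmul_fun r).
Proof.
exact: (@tensor_lift_additive R MR Rf localized
  (fun (m : MR) (g : Rf) => lpure m (to_loc f r * (g : loc f)))
  (lmul_Dl r) (lmul_Dr r) (lmul_Z r)).
Qed.

Lemma mderivB_morph (i : 'I_n) : zmod_morphism (@mderiv n K i).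
Proof. by move=> r s; rewrite mderivB. Qed.

Let lder_Dl i m m' g :
  lpure (wder i *: (m + m')) g + lpure (m + m') (loc_der (mderiv i) g)
  = lpure (wder i *: m) g + lpure m (loc_der (mderiv i) g)
    + (lpure (wder i *: m') g + lpure m' (loc_der (mderiv i) g)).
Proof. by rewrite scalerDr !lpureDl addrACA. Qed.
Let lder_Dr i m g g' :
  lpure (wder i *: m) (g + g') + lpure m (loc_der (mderiv i) (g + g'))
  = lpure (wder i *: m) g + lpure m (loc_der (mderiv i) g)
    + (lpure (wder i *: m) g' + lpure m (loc_der (mderiv i) g')).
Proof.
by rewrite (loc_derD (mderivB_morph i) (mderivM i)) !lpureDr addrACA.
Qed.
Let lder_Z i s m g :
  lpure (wder i *: (wpol s *: m)) g
    + lpure (wpol s *: m) (loc_der (mderiv i) g)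
  = lpure (wder i *: m) (to_loc f s * g)
    + lpure m (loc_der (mderiv i) (to_loc f s * g)).
Proof.
rewrite (loc_der_mul (mderivB_morph i) (mderivM i)) lpureDr addrA scalerA.
by rewrite wleibniz scalerDl -scalerA lpureDl !lpureZ addrAC -!addrA.
Qed.

Lemma lder_lpure i m g : lder_fun i (lpure m g)
  = lpure (wder i *: m) g + lpure m (loc_der (mderiv i) g).
Proof.
exact: (@tensor_liftE R MR Rf localized
  (fun (m : MR) (g : Rf) =>
    lpure (wder i *: (m : M)) g + lpure m (loc_der (mderiv i) (g : loc f)))
  (lder_Dl i) (lder_Dr i) (lder_Z i)).
Qed.
Lemma lder_additive i : zmod_morphism (lder_fun i).
Proof.
exact: (@tensor_lift_additive R MR Rf localized
  (fun (m : MR) (g : Rf) =>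
    lpure (wder i *: (m : M)) g + lpure m (loc_der (mderiv i) (g : loc f)))
  (lder_Dl i) (lder_Dr i) (lder_Z i)).
Qed.

Definition lmul (r : R) : endo localized := Endo (lmul_additive r).
Definition lder (i : 'I_n) : endo localized := Endo (lder_additive i).

Lemma localized_endoP (a b : endo localized) :
  (forall m g, a (lpure m g) = b (lpure m g)) -> a = b.
Proof.
move=> H; apply: endoP; apply: tensor_ind => [|t u Ht Hu|m g].
- by rewrite [LHS](raddf0 a) [RHS](raddf0 b).
- by rewrite [LHS](endoB a) [RHS](endoB b); congr (_ - _).
- exact: H.
Qed.

Lemma lmul_morphB : zmod_morphism lmul.
Proof.
move=> r s; apply: localized_endoP => m g.
change (lmul_fun (r - s) (lpure m g)
  = lmul_fun r (lpure m g) - lmul_fun s (lpure m g)).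
rewrite !lmul_lpure raddfB mulrBl; apply/eqP; rewrite eq_sym subr_eq -lpureDr.
by rewrite subrK.
Qed.
Lemma lmul_morphM : monoid_morphism lmul.
Proof.
split=> [|r s]; apply: localized_endoP => m g.
  by rewrite [LHS]lmul_lpure rmorph1 mul1r.
change (lmul_fun (r * s) (lpure m g) = lmul_fun r (lmul_fun s (lpure m g))).
by rewrite !lmul_lpure rmorphM mulrA.
Qed.
HB.instance Definition _ := GRing.isZmodMorphism.Build R (endo localized) lmul
  lmul_morphB.
HB.instance Definition _ := GRing.isMonoidMorphism.Build R (endo localized) lmul
  lmul_morphM.

Lemma lder_comm i j : lder i * lder j = lder j * lder i.
Proof.
apply: localized_endoP => m g.
change (lder_fun i (lder_fun j (lpure m g)) = lder_fun j (lder_fun i (lpure m g))).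
rewrite !lder_lpure -[lder_fun i]/(lder i : _ -> _) -[lder_fun j]/(lder j : _ -> _).
rewrite !raddfD /= !lder_lpure !scalerA wderC.
rewrite (loc_derC (mderivB_morph i) (mderivM i) (mderivB_morph j) (mderivM j));
  last exact: mderiv_comm.
exact: addrACA.
Qed.

Lemma lder_leibniz i r : lder i * lmul r = lmul r * lder i + lmul r^`M(i).
Proof.
apply: localized_endoP => m g.
change (lder_fun i (lmul_fun r (lpure m g))
  = lmul r (lder_fun i (lpure m g)) + lmul_fun r^`M(i) (lpure m g)).
rewrite lmul_lpure !lder_lpure raddfD /= !lmul_lpure -addrA; congr (_ + _).
by rewrite (loc_der_mul (mderivB_morph i) (mderivM i)) lpureDr addrC.
Qed.

Definition lact : D -> endo localized := weyl_lift lmul lder.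

Lemma lact_additive : zmod_morphism lact.
Proof. exact: (weyl_lift_additive lder_comm lder_leibniz). Qed.
Lemma lact_multiplicative : monoid_morphism lact.
Proof. exact: (weyl_lift_multiplicative lder_comm lder_leibniz). Qed.

Definition localized_scale (P : D) (t : localized) : localized := lact P t.

HB.instance Definition _ := GRing.isZmodMorphism.Build D (endo localized) lact
  lact_additive.
HB.instance Definition _ := GRing.isMonoidMorphism.Build D (endo localized) lact
  lact_multiplicative.

Lemma localized_scalerA P Q t :
  localized_scale P (localized_scale Q t) = localized_scale (P * Q) t.
Proof. by rewrite /localized_scale rmorphM. Qed.
Lemma localized_scale1r : left_id 1 localized_scale.
Proof. by move=> t; rewrite /localized_scale rmorph1. Qed.
Lemma localized_scalerDr : right_distributive localized_scale +%R.
Proof. by move=> P t u; rewrite /localized_scale raddfD. Qed.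
Lemma localized_scalerDl t : {morph localized_scale^~ t : P Q / P + Q}.
Proof. by move=> P Q; rewrite /localized_scale rmorphD. Qed.

HB.instance Definition _ := GRing.Zmodule_isLmodule.Build D localized
  localized_scalerA localized_scale1r localized_scalerDr localized_scalerDl.

Lemma wpol_lpure r m g : wpol r *: lpure m g = lpure m (to_loc f r * g).
Proof.
rewrite -lmul_lpure; have E : lact (wpol r) = lmul r.
  exact: (weyl_lift_pol lder_comm lder_leibniz).
by change (endo_fun (lact (wpol r)) (lpure m g) = lmul r (lpure m g)); rewrite E.
Qed.

Lemma wder_lpure i m g :
  wder i *: lpure m g = lpure (wder i *: m) g + lpure m (loc_der (mderiv i) g).
Proof.
rewrite -lder_lpure; have E : lact (wder i) = lder i.
  exact: (weyl_lift_der lder_comm lder_leibniz).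
by change (endo_fun (lact (wder i)) (lpure m g) = lder i (lpure m g)); rewrite E.
Qed.

Definition loc_map (m : M) : localized := lpure m 1.

End LocalizedModule.

(* Main.v *)
Require Import Defs.
From HB Require Import structures.
From mathcomp Require Import all_boot all_order all_algebra.
From mathcomp Require Import boolp functions.
From mathcomp Require Import mpoly.
From mathcomp Require Import ring.

(** Write N for the quotient of D_v in the theorem and L for M (x) R_f.  The
    factor D_v.{1 - fv, phi(J)} puts v = 1/f, and the quotient by d_v D_v is
    integration along v, so an additive map Phi : D_v -> L that kills d_v D_v
    is governed by its moments b_j = Phi(v^j X).  The moments of v X are
    shifted, those of P X for P in D are P b_j, and since
    v^j d_v = d_v v^j - j v^(j-1), those of d_v X are - j b_(j-1).  These
    three rules make the sequences in any left D-module a left D_v-module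
    (moment_act).

    For m in M let e_m be the sequence of moments m (x) f^-(j+2).  The shift
    acts on it as 1/f, so 1 - fv kills e_m (graph_moments).  In
    phi(d_i) = d_i - v^2 (df/dx_i) d_v the second term contributes
    (j+2) (df/dx_i) f^-(j+3), which cancels the derivative of f^-(j+2):
    this is what forces the exponent 2, and it gives phi(P) e_m = e_(P m)
    (phi_moments).  With m the class of 1 in D/J, phi(J) kills e_m as well,
    so X |-> (X e_m)_0 factors through a D-linear map N -> L, which sends
    r v^k phi(P) to P (x) r/f^(k+2) (integrate_pairing).

    The inverse sends P (x) r/f^k to the class of f^2 r v^k phi(P)
    (unlocalize).  It is well defined because 1 - fv commutes with phi(P) up
    to a change of the left factor (graph_phi), so that fv acts as 1 on the
    classes of q phi(P).  Finally D_v is the sum of the d_v^j K[x,v] phi(D)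
    (normal_formP), so N is spanned by the classes of r v^k phi(P), and on
    these the two maps are visibly inverse to each other. *)

Set Implicit Arguments.
Unset Strict Implicit.
Unset Printing Implicit Defensive.

Import GRing.Theory.
Local Open Scope ring_scope.

(** * Linear maps out of a quotient module *)

Section QuotientLift.
Variables (B : pzRingType) (V W : lmodType B) (S : submodClosed V).
Variable h : {linear V -> W}.
Hypothesis hS : forall x, x \in S -> h x = 0.

Definition quot_lift (q : modquot S) : W := h (repr q).

Lemma quot_lift_cls x : quot_lift (cls S x) = h x.
Proof.
apply/eqP; rewrite -subr_eq0 -linearB hS //.
by apply/cls_eqP; rewrite cls_repr.
Qed.

Lemma quot_lift_additive : zmod_morphism quot_lift.
Proof.
move=> p q; rewrite -(cls_repr p) -(cls_repr q) -raddfB !quot_lift_cls.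
exact: raddfB.
Qed.

Lemma quot_lift_scalable : scalable quot_lift.
Proof.
by move=> a q; rewrite -(cls_repr q) scale_clsE !quot_lift_cls linearZ.
Qed.

HB.instance Definition _ :=
  GRing.isZmodMorphism.Build (modquot S) W quot_lift quot_lift_additive.
HB.instance Definition _ :=
  GRing.isScalable.Build B (modquot S) W *:%R quot_lift quot_lift_scalable.

Definition quot_linear : {linear modquot S -> W} := quot_lift.

Lemma quot_linear_cls x : quot_linear (cls S x) = h x.
Proof. exact: quot_lift_cls. Qed.
End QuotientLift.

(** * Polynomials in x and v *)

Section LastVariable.
Variables (K : fieldType) (n : nat).
Local Notation R := {mpoly K[n]}.
Local Notation Rv := {mpoly K[n.+1]}.
Local Notation v := ('X_ord_max : Rv).

Lemma xwidenE (i : 'I_n) : xwiden i = fintype.lift ord_max i.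
Proof. by apply/val_inj; rewrite /= /bump leqNgt ltn_ord. Qed.

(** A polynomial in x and v is a sum of terms r(x) v^k, the form in which D_v
    acts on moments and in which fractions r/f^k are lifted. *)
Lemma mpoly_last_ind (P : Rv -> Prop) :
  (forall r k, P (mwiden r * v ^+ k)) ->
  (forall p q, P p -> P q -> P (p + q)) -> forall q, P q.
Proof.
move=> Pm PD; elim/mpolyind=> [|c m p _ _ Pp].
  by have := Pm 0 0%N; rewrite mwiden0 mul0r.
apply: PD => //; pose m' : 'X_{1..n} := [multinom m (xwiden i) | i < n].
suff -> : c *: 'X_[m] = mwiden (c *: 'X_[m']) * v ^+ (m ord_max) by [].
rewrite mwidenZ mwidenX -scalerAl mpolyXn -mpolyXD; congr (_ *: 'X_[_]).
apply/mnmP=> i; rewrite mnmDE mulmnE mnm1E.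
case: (unliftP ord_max i) => [j ->|->].
  by rewrite -xwidenE mnmwiden_widen mnmE eq_sym (negPf (_ : _ != _)) ?addn0 //
    xwidenE eq_sym neq_lift.
by rewrite mnmwiden_ordmax eqxx mul1n.
Qed.

Lemma muni_last : muni v = 'X.
Proof.
rewrite muniE msuppX big_seq1 mcoeffX eqxx scale1r mnm1E eqxx.
rewrite (_ : [multinom _ | i < n] = 0%MM) ?mpolyX0 ?scale1r ?expr1 //.
apply/mnmP=> i; rewrite mnmE mnm0E mnm1E.
case: eqP => // /(congr1 val) /= e; by have := ltn_ord i; rewrite -e ltnn.
Qed.

Lemma muni_widen (r : R) : muni (mwiden r) = r%:P.
Proof.
elim/mpolyind: r => [|c m p _ _ IH]; first by rewrite mwiden0 muni0.
rewrite mwidenD muniD IH polyCD; congr (_ + _).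
rewrite mwidenZ muniZ mwidenX muniE msuppX big_seq1 mcoeffX eqxx scale1r.
rewrite mnmwiden_ordmax expr0 -mul_mpolyC polyCM -!mul_polyC mulr1.
congr (_ * _%:P); congr 'X_[_].
by apply/mnmP=> i; rewrite mnmE mnmwiden_widen.
Qed.

Lemma mderiv_last_widen (i : 'I_n) : v^`M(xwiden i) = 0.
Proof.
by rewrite mderivX mnm1E xwidenE (negPf (neq_lift _ _)) scale0r.
Qed.

Lemma mderiv_last : v^`M(ord_max) = 1.
Proof.
rewrite mderivX mnm1E eqxx scale1r (_ : (_ - _)%MM = 0%MM) ?mpolyX0 //.
by apply/mnmP=> i; rewrite mnmBE subnn mnm0E.
Qed.
End LastVariable.

(** * The Leibniz relation of a Weyl algebra *)

Section Leibniz.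
Variables (K : fieldType) (N : nat) (B : pzRingType).
Variables (g : {rmorphism {mpoly K[N]} -> B}) (d : B) (i : 'I_N).
Implicit Types p q : {mpoly K[N]}.

(** The polynomials for which the relation holds form a subring, so that it only
    has to be checked on ring generators. *)
Definition leibniz_for p := d * g p = g p * d + g p^`M(i).

Lemma leibniz_one : leibniz_for 1.
Proof.
rewrite /leibniz_for -mpolyC1 mderivC mpolyC1 rmorph0 rmorph1.
by rewrite mulr1 mul1r addr0.
Qed.

Lemma leibniz_add p q : leibniz_for p -> leibniz_for q -> leibniz_for (p + q).
Proof.
rewrite /leibniz_for => Hp Hq; rewrite mderivD !rmorphD mulrDr mulrDl Hp Hq.
exact: addrACA.
Qed.

Lemma leibniz_mul p q : leibniz_for p -> leibniz_for q -> leibniz_for (p * q).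
Proof.
rewrite /leibniz_for => Hp Hq; rewrite mderivM rmorphD !rmorphM mulrA Hp mulrDl.
by rewrite -!mulrA Hq mulrDr -addrA [X in _ + X]addrC.
Qed.
End Leibniz.

(** * The D_v-module of moment sequences *)

Section Moments.
Variables (K : fieldType) (n : nat).
Local Notation R := {mpoly K[n]}.
Local Notation Rv := {mpoly K[n.+1]}.
Local Notation D := (weyl K n).
Local Notation Dv := (weyl K n.+1).
Local Notation v := ('X_ord_max : Rv).
Variable L : lmodType D.

(** A sequence b stands for the additive map K[v] -> L with v^j |-> b_j. *)
Definition moments : zmodType := (nat -> L).
Implicit Types (b c : moments) (p q : {poly R}).

Lemma momentsD b c j : (b + c) j = b j + c j. Proof. by []. Qed.
Lemma momentsN b j : (- b) j = - b j. Proof. by []. Qed.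

Lemma endoD (a a' : endo moments) b : (a + a') b = a b + a' b. Proof. by []. Qed.
Lemma endoM (a a' : endo moments) b : (a * a') b = a (a' b). Proof. by []. Qed.

Lemma moment_shift_proof :
  zmod_morphism (fun b : moments => (fun j => b j.+1) : moments).
Proof. by []. Qed.
Definition moment_shift : endo moments := Endo moment_shift_proof.

Lemma moment_scale_proof (P : D) :
  zmod_morphism (fun b : moments => (fun j => P *: b j) : moments).
Proof. by move=> b c; apply/funext=> j; exact: scalerBr. Qed.
Definition moment_scale (P : D) : endo moments := Endo (moment_scale_proof P).

(** The action of d_v is minus the transpose of d/dv, because integration along v
    kills d_v D_v.  At j = 0 the multiple by j is zero, whatever the value of the
    sequence at the truncated predecessor. *)
Lemma moment_dv_proof :
  zmod_morphism (fun b : moments => (fun j => - (b j.-1 *+ j)) : moments).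
Proof.
move=> b c; apply/funext=> j; rewrite momentsD !momentsN momentsD momentsN.
by rewrite mulrnBl opprD.
Qed.
Definition moment_dv : endo moments := Endo moment_dv_proof.

(** The ring K[x,v] acts through K[x][v]: v^i shifts by i places and the
    coefficients act termwise. *)
Lemma coef_act_proof p : zmod_morphism (fun b : moments =>
  (fun j => \sum_(i < size p) wpol p`_i *: b (i + j)%N) : moments).
Proof.
move=> b c; apply/funext=> j; rewrite momentsD momentsN -sumrB.
by apply: eq_bigr => i _; rewrite momentsD momentsN scalerBr.
Qed.
Definition coef_act p : endo moments := Endo (coef_act_proof p).

Lemma coef_act_wide N p b j : (size p <= N)%N ->
  coef_act p b j = \sum_(i < N) wpol p`_i *: b (i + j)%N.
Proof.
move=> le; rewrite /= (big_ord_widen N (fun i => wpol p`_i *: b (i + j)%N)) //.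
rewrite big_mkcond; apply: eq_bigr => i _; case: ltnP => // /(nth_default 0) ->.
by rewrite rmorph0 scale0r.
Qed.

Lemma coef_act_additive : zmod_morphism coef_act.
Proof.
move=> p q; apply: endoP => b; apply/funext=> j.
pose N := maxn (size p) (size q).
have leB : (size (p - q)%R <= N)%N by rewrite /N -[size q]size_polyN size_polyD.
rewrite (coef_act_wide b j leB).
transitivity (coef_act p b j - coef_act q b j); last by [].
rewrite (coef_act_wide b j (leq_maxl _ _ : (_ <= N)%N)).
rewrite (coef_act_wide b j (leq_maxr _ _ : (_ <= N)%N)) -sumrB.
by apply: eq_bigr => i _; rewrite coefB rmorphB scalerBl.
Qed.
HB.instance Definition _ := GRing.isZmodMorphism.Build {poly R} (endo moments)
  coef_act coef_act_additive.

Lemma coef_actC r : coef_act r%:P = moment_scale (wpol r).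
Proof.
apply: endoP => b; apply/funext=> j.
by rewrite (coef_act_wide b j (size_polyC_leq1 r)) big_ord1 coefC.
Qed.

Lemma coef_actMX p : coef_act (p * 'X) = coef_act p * moment_shift.
Proof.
apply: endoP => b; apply/funext=> j; rewrite endoM.
have le : (size (p * 'X)%R <= (size p).+1)%N.
  by rewrite (leq_trans (size_polyMleq _ _)) // size_polyX addn2.
rewrite (coef_act_wide b j le) big_ord_recl coefMX rmorph0 scale0r add0r.
by apply: eq_bigr => i _; rewrite coefMX /= addSn.
Qed.

Lemma coef_act_shift p : coef_act p * moment_shift = moment_shift * coef_act p.
Proof.
apply: endoP => b; apply/funext=> j; rewrite !endoM /=.
by apply: eq_bigr => i _; rewrite addnS.
Qed.

(** By induction on the degree of p, since p X acts as p after a shift and the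
    shift commutes with the action of q. *)
Lemma coef_act_multiplicative : monoid_morphism coef_act.
Proof.
split=> [|p q].
  by rewrite -polyC1 coef_actC rmorph1; apply: endoP => b;
    apply/funext=> j; exact: scale1r.
elim/poly_ind: p => [|p r IH]; first by rewrite mul0r raddf0 mul0r.
rewrite mulrDl !raddfD mulrDl /= -mulrA -commr_polyX mulrA !coef_actMX IH.
rewrite -!mulrA coef_act_shift; congr (_ + _).
apply: endoP => b; apply/funext=> j; rewrite endoM coef_actC.
have le : (size (r%:P * q)%R <= size q)%N by rewrite mul_polyC size_scale_leq.
rewrite (coef_act_wide b j le) /= scaler_sumr; apply: eq_bigr => i _.
by rewrite coefCM rmorphM scalerA.
Qed.
HB.instance Definition _ := GRing.isMonoidMorphism.Build {poly R} (endo moments)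
  coef_act coef_act_multiplicative.

Definition moment_pol : {rmorphism Rv -> endo moments} := coef_act \o @muni n K.

Lemma moment_pol_widen r : moment_pol (mwiden r) = moment_scale (wpol r).
Proof. by rewrite /= muni_widen coef_actC. Qed.

Lemma moment_pol_last : moment_pol v = moment_shift.
Proof. by rewrite /= muni_last -['X]mul1r coef_actMX rmorph1 mul1r. Qed.

Definition moment_der (i : 'I_n.+1) : endo moments :=
  if unlift ord_max i is Some j then moment_scale (wder j) else moment_dv.

Lemma moment_der_widen (i : 'I_n) : moment_der (xwiden i) = moment_scale (wder i).
Proof. by rewrite /moment_der xwidenE liftK. Qed.

Lemma moment_der_last : moment_der ord_max = moment_dv.
Proof. by rewrite /moment_der unlift_none. Qed.

Lemma moment_scale_dv P :
  moment_scale P * moment_dv = moment_dv * moment_scale P.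
Proof.
apply: endoP => b; apply/funext=> j; rewrite !endoM /=.
by rewrite scalerN scalerMnr.
Qed.

Lemma moment_scale_shift P :
  moment_scale P * moment_shift = moment_shift * moment_scale P.
Proof. by apply: endoP. Qed.

Lemma moment_scaleM P Q :
  moment_scale P * moment_scale Q = moment_scale (P * Q).
Proof. by apply: endoP => b; apply/funext=> j; exact: scalerA. Qed.

Lemma moment_scaleD P Q :
  moment_scale P + moment_scale Q = moment_scale (P + Q).
Proof. by apply: endoP => b; apply/funext=> j; rewrite /= scalerDl. Qed.

Lemma moment_der_comm i j :
  moment_der i * moment_der j = moment_der j * moment_der i.
Proof.
rewrite /moment_der; case: unliftP => [i' _|_]; case: unliftP => [j' _|_] //.
- by rewrite !moment_scaleM wderC.
- exact: moment_scale_dv.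
- by rewrite moment_scale_dv.
Qed.

(** The relation d_v v = v d_v + 1 between operators: at place j it reads
    - j b_j = - (j+1) b_j + b_j. *)
Lemma moment_dv_shift :
  moment_dv * moment_shift = moment_shift * moment_dv + 1.
Proof.
apply: endoP => b; apply/funext=> -[|j]; rewrite endoD !endoM momentsD /=.
  by rewrite mulr0n mulr1n oppr0 addNr.
by rewrite [b j.+1 *+ j.+2]mulrSr opprD subrK.
Qed.

Lemma moment_der_leibniz i (q : Rv) :
  moment_der i * moment_pol q
  = moment_pol q * moment_der i + moment_pol q^`M(i).
Proof.
pose good (q : Rv) := leibniz_for moment_pol (moment_der i) i q.
have goodM (p r : Rv) : good p -> good r -> good (p * r) by exact: leibniz_mul.
have goodD (p r : Rv) : good p -> good r -> good (p + r) by exact: leibniz_add.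
have good1 : good 1 by exact: leibniz_one.
have good_last : good v.
  rewrite /good /leibniz_for moment_pol_last /moment_der.
  case: unliftP => [i' ->|->].
    by rewrite -xwidenE mderiv_last_widen rmorph0 addr0 moment_scale_shift.
  by rewrite mderiv_last rmorph1 moment_dv_shift.
have good_lastX k : good (v ^+ k).
  elim: k => [|k IH]; first exact: good1.
  rewrite exprS; exact: goodM.
suff : good q by [].
apply: (@mpoly_last_ind _ _ good); last exact: goodD.
move=> r k; apply: (goodM _ _ _ (good_lastX k)).
rewrite /good /leibniz_for moment_pol_widen /moment_der.
case: unliftP => [i' ->|->].
  rewrite -xwidenE mderiv_widen moment_pol_widen !moment_scaleM wleibniz.
  by rewrite moment_scaleD.
by rewrite mderiv_widen_max rmorph0 addr0 moment_scale_dv.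
Qed.

Definition moment_act : Dv -> endo moments := weyl_lift moment_pol moment_der.

HB.instance Definition _ := GRing.isZmodMorphism.Build Dv (endo moments)
  moment_act (weyl_lift_additive moment_der_comm moment_der_leibniz).
HB.instance Definition _ := GRing.isMonoidMorphism.Build Dv (endo moments)
  moment_act (weyl_lift_multiplicative moment_der_comm moment_der_leibniz).

Lemma moment_act_incl P : moment_act (weyl_incl P) = moment_scale P.
Proof.
elim/weyl_ind: P => [r|i|P Q HP HQ|P Q HP HQ].
- rewrite weyl_incl_pol [LHS](weyl_lift_pol moment_der_comm moment_der_leibniz).
  exact: moment_pol_widen.
- rewrite weyl_incl_der [LHS](weyl_lift_der moment_der_comm moment_der_leibniz).
  exact: moment_der_widen.
- by rewrite !rmorphD /= HP HQ moment_scaleD.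
- by rewrite !rmorphM /= HP HQ moment_scaleM.
Qed.

Lemma moment_act_wv : moment_act (wv K n) = moment_shift.
Proof.
rewrite [LHS](weyl_lift_pol moment_der_comm moment_der_leibniz).
exact: moment_pol_last.
Qed.

Lemma moment_act_wdv : moment_act (wdv K n) = moment_dv.
Proof.
rewrite [LHS](weyl_lift_der moment_der_comm moment_der_leibniz).
exact: moment_der_last.
Qed.
End Moments.

(** * The moments of powers of 1/f *)

Section FractionArithmetic.
Variables (A : comNzRingType) (f : A).

Lemma locfrac0 k : locfrac f 0 k = 0.
Proof. by apply: locfrac_eq; rewrite !mul0r. Qed.

Lemma locfrac_addl g h k : locfrac f g k + locfrac f h k = locfrac f (g + h) k.
Proof.
by rewrite locfrac_add; apply: locfrac_eq; rewrite -mulrDl exprD mulrA.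
Qed.

Lemma locfracMn g k j : locfrac f g k *+ j = locfrac f (g *+ j) k.
Proof.
elim: j => [|j IH]; first by rewrite !mulr0n locfrac0.
by rewrite !mulrS IH locfrac_addl.
Qed.
End FractionArithmetic.

Section PowerMoments.
Variables (K : fieldType) (n : nat) (f : {mpoly K[n]}).
Local Notation D := (weyl K n).
Variable M : lmodType D.
Local Notation L := (localized f M).

(** The moments of m (x) f^-2 when v acts as 1/f.  The offset 2 is the one for
    which phi acts on these sequences through its argument: see the lemma
    phi_der_moments. *)
Definition pow_moments (m : M) : moments L :=
  fun j => lpure m (locfrac f 1 j.+2).

Lemma pow_momentsD m m' : pow_moments (m + m') = pow_moments m + pow_moments m'.
Proof. by apply/funext=> j; exact: lpureDl. Qed.

Lemma moment_act_pol r : moment_act L (pol_incl r) = moment_scale L (wpol r).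
Proof. by rewrite -weyl_incl_pol moment_act_incl. Qed.

Lemma lpure0 (m : M) : lpure m 0 = 0 :> L.
Proof. by apply: (addrI (lpure m 0)); rewrite -lpureDr !addr0. Qed.

Lemma lpureMn (m : M) (g : loc f) k : lpure m (g *+ k) = lpure m g *+ k.
Proof.
by elim: k => [|k IH]; rewrite ?mulr0n ?lpure0 // !mulrS lpureDr IH.
Qed.

Lemma wpol_locfrac (m : M) r g k :
  wpol r *: lpure m (locfrac f g k) = lpure m (locfrac f (r * g) k).
Proof. by rewrite wpol_lpure /to_loc locfrac_mul add0n. Qed.

(** The term in v^2 d_v of phi(d_i) lowers the index by one and raises it by two;
    the factor j + 2 that it produces matches the exponent of f^-(j+2), so its
    contribution cancels the derivative of f^-(j+2). *)
Lemma phi_der_moments i (m : M) :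
  moment_act L (phi f (wder i)) (pow_moments m) = pow_moments (wder i *: m).
Proof.
rewrite phi_wder rmorphB 2!rmorphM rmorphXn /= moment_act_wv moment_act_wdv.
rewrite -weyl_incl_der moment_act_incl moment_act_pol.
apply/funext=> j.
transitivity (wder i *: lpure m (locfrac f 1 j.+2) -
  wpol f^`M(i) *: - (lpure m (locfrac f 1 j.+3) *+ j.+2)); first by [].
rewrite wder_lpure -addrA -[RHS]addr0; congr (_ + _).
rewrite scalerN opprK -scalerMnr wpol_locfrac mulr1 -lpureMn -lpureDr.
rewrite (loc_derE f (mderivB_morph i) (mderivM i)).
rewrite -mpolyC1 mderivC mul0r mpolyC1 mul1r sub0r.
by rewrite locfracMn locfrac_addl addNr locfrac0 lpure0.
Qed.

(** Both sides are compatible with sums and products of operators, which reduces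
    the statement to polynomials and to the d_i. *)
Lemma phi_moments P (m : M) :
  moment_act L (phi f P) (pow_moments m) = pow_moments (P *: m).
Proof.
elim/weyl_ind: P m => [r|i|P Q HP HQ|P Q HP HQ] m.
- rewrite phi_pol moment_act_pol; apply/funext=> j.
  by rewrite [LHS]wpol_lpure [RHS]lpureZ.
- exact: phi_der_moments.
- by rewrite !rmorphD endoD HP HQ -pow_momentsD scalerDl.
- by rewrite !rmorphM endoM HQ HP scalerA.
Qed.

Lemma graph_moments (m : M) :
  moment_act L (1 - pol_incl f * wv K n) (pow_moments m) = 0.
Proof.
rewrite rmorphB rmorphM rmorph1 /= moment_act_pol moment_act_wv.
apply/funext=> j.
transitivity (lpure m (locfrac f 1 j.+2) - wpol f *: lpure m (locfrac f 1 j.+3)).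
  by [].
rewrite wpol_locfrac mulr1 (@locfrac_eq _ f f j.+3 1 j.+2) ?subrr //.
by rewrite mul1r -exprS.
Qed.

(** On the operators r v^k phi(P), which span D_v modulo d_v D_v, the zeroth
    moment has this closed form. *)
Lemma moment_pairing (r : {mpoly K[n]}) k P (m : M) :
  moment_act L (pol_incl r * wv K n ^+ k * phi f P) (pow_moments m) 0%N
  = lpure (P *: m) (locfrac f r k.+2).
Proof.
have powE j b : moment_act L (wv K n ^+ k) b j = b (k + j)%N.
  elim: k b j => [|l IH] b j; first by rewrite expr0 rmorph1.
  by rewrite exprSr rmorphM [LHS]IH /= moment_act_wv.
transitivity (moment_act L (pol_incl r)
  (moment_act L (wv K n ^+ k) (moment_act L (phi f P) (pow_moments m))) 0%N).
  by rewrite !rmorphM.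
rewrite moment_act_pol.
transitivity (wpol r *: (moment_act L (wv K n ^+ k)
  (moment_act L (phi f P) (pow_moments m))) 0%N); first by [].
by rewrite powE addn0 phi_moments wpol_locfrac mulr1.
Qed.

End PowerMoments.

(** * Decomposition of D_v along phi(D) *)

Section Shear.
Variables (K : fieldType) (n : nat) (f : {mpoly K[n]}).
Local Notation Rv := {mpoly K[n.+1]}.
Local Notation D := (weyl K n).
Local Notation Dv := (weyl K n.+1).
Local Notation v := ('X_ord_max : Rv).
Local Notation fv := (mwiden f * v).

(** The derivation of K[x,v] induced by bracketing with phi(d_i).  It is tangent
    to the hypersurface fv = 1, which is the content of shear_deriv_graph. *)
Definition shear_deriv (i : 'I_n) (q : Rv) : Rv :=
  q^`M(xwiden i) - v ^+ 2 * mwiden f^`M(i) * q^`M(ord_max).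

Lemma phi_wder_wpol i : phi f (wder i) =
  wder (xwiden i) - wpol (v ^+ 2 * mwiden f^`M(i)) * wdv K n.
Proof. by rewrite phi_wder wv2E [wpol (_ * mwiden _)]rmorphM. Qed.

Lemma phi_wder_pol i q :
  phi f (wder i) * wpol q = wpol q * phi f (wder i) + wpol (shear_deriv i q).
Proof.
rewrite phi_wder_wpol /shear_deriv; move: (_ * mwiden _) => c.
rewrite mulrBl wleibniz -mulrA wleibniz mulrDr mulrBr rmorphB rmorphM.
by rewrite opprD addrACA !mulrA [wpol q * wpol _]wpolC.
Qed.

Lemma shear_deriv_graph i :
  shear_deriv i (1 - fv) = - (mwiden f^`M(i) * v) * (1 - fv).
Proof.
rewrite /shear_deriv !mderivB -mpolyC1 !mderivC mpolyC1 !mderivM.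
rewrite mderiv_widen mderiv_widen_max mderiv_last_widen mderiv_last.
by ring.
Qed.

(** The left ideal of 1 - fv is stable under right multiplication by phi(D),
    because the derivations above map 1 - fv to multiples of itself. *)
Lemma graph_phi P : exists Y : Dv, wpol (1 - fv) * phi f P = Y * wpol (1 - fv).
Proof.
elim/weyl_ind: P => [r|i|P Q [Y HY] [Z HZ]|P Q [Y HY] [Z HZ]].
- by exists (phi f (wpol r)); rewrite phi_pol wpolC.
- exists (phi f (wder i) + wpol (mwiden f^`M(i) * v)).
  rewrite mulrDl phi_wder_pol shear_deriv_graph -rmorphM mulNr rmorphN.
  by rewrite subrK.
- by exists (Y + Z); rewrite [phi f _]rmorphD mulrDr mulrDl HY HZ.
- by exists (Y * Z); rewrite [phi f _]rmorphM mulrA HY -mulrA HZ mulrA.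
Qed.

(** Membership in the sum over j of d_v^j K[x,v] phi(D). *)
Inductive normal_form : Dv -> Prop :=
| normal_base q P : normal_form (wpol q * phi f P)
| normal_wdv X : normal_form X -> normal_form (wdv K n * X)
| normal_add X Y : normal_form X -> normal_form Y -> normal_form (X + Y).

Lemma normal_wpol q X : normal_form X -> normal_form (wpol q * X).
Proof.
move=> nX; elim: nX q => [p P|Y nY IH|Y Z _ IHY _ IHZ] q.
- by rewrite mulrA -rmorphM; apply: normal_base.
- have -> : wpol q * (wdv K n * Y)
      = wdv K n * (wpol q * Y) + wpol (- q^`M(ord_max)) * Y.
    by rewrite !mulrA [wdv K n * _]wleibniz mulrDl rmorphN mulNr addrK.
  by apply: normal_add; [apply: normal_wdv | ]; apply: IH.
- by rewrite mulrDr; apply: normal_add.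
Qed.

Lemma normal_wder i X : normal_form X -> normal_form (wder i * X).
Proof.
case: (unliftP ord_max i) => [j ->|->]; last exact: normal_wdv.
rewrite -xwidenE; elim=> [q P|Y nY IH|Y Z _ IHY _ IHZ].
- have -> : wder (xwiden j) * (wpol q * phi f P) =
      wpol q * phi f (wder j * P) + wpol (shear_deriv j q) * phi f P
      + wpol (v ^+ 2 * mwiden f^`M(j)) * (wdv K n * (wpol q * phi f P)).
    rewrite rmorphM !mulrA -mulrDl -phi_wder_pol phi_wder_wpol.
    by rewrite mulrBl mulrBl subrK.
  apply: normal_add; first by apply: normal_add; apply: normal_base.
  by apply/normal_wpol/normal_wdv/normal_base.
- by rewrite mulrA wderC -mulrA; apply: normal_wdv.
- by rewrite mulrDr; apply: normal_add.
Qed.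

(** The normal forms contain 1 and are stable under left multiplication by the
    generators of D_v: d_v crosses polynomials by the Leibniz rule, and each d_i
    is phi(d_i) plus a polynomial multiple of d_v. *)
Lemma normal_formP X : normal_form X.
Proof.
suff : forall Y, normal_form Y -> normal_form (X * Y).
  move/(_ 1); rewrite mulr1; apply.
  by have := normal_base 1 1; rewrite !rmorph1 mulr1.
elim/weyl_ind: X => [q|i|X Y HX HY|X Y HX HY] Z nZ.
- exact: normal_wpol.
- exact: normal_wder.
- by rewrite mulrDl; apply: normal_add; auto.
- by rewrite -mulrA; auto.
Qed.

(** Since terms with d_v in front vanish after integration, only the terms with
    j = 0 need to be examined. *)
Lemma weyl_shear_ind (P : Dv -> Prop) :
  (forall r k Q, P (pol_incl r * wv K n ^+ k * phi f Q)) ->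
  (forall X, P (wdv K n * X)) ->
  (forall X Y, P X -> P Y -> P (X + Y)) -> forall X, P X.
Proof.
move=> Pb Pd PD X; elim: (normal_formP X) => [q Q|Y _ _|Y Z _ PY _ PZ].
- elim/mpoly_last_ind: q => [r k|p q Hp Hq].
    by rewrite rmorphM rmorphXn; exact: Pb.
  by rewrite rmorphD mulrDl; apply: PD.
- exact: Pd.
- exact: PD.
Qed.
End Shear.

(** * The two mutually inverse maps *)

Section Inverse.
Variables (K : fieldType) (n : nat) (f : {mpoly K[n]}).
Local Notation R := {mpoly K[n]}.
Local Notation D := (weyl K n).
Local Notation Dv := (weyl K n.+1).
Local Notation v := ('X_ord_max : {mpoly K[n.+1]}).
Local Notation fv := (mwiden f * v).
Variable J : submodClosed D^o.
Local Notation N := (dv_submod f J).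

Definition dv_cls (X : Dv) : dv_quotient f J := cls N X.

Lemma dv_clsD X Y : dv_cls (X + Y) = dv_cls X + dv_cls Y.
Proof. exact: (raddfD (cls N)). Qed.

Lemma dv_cls_wdv X : dv_cls (wdv K n * X) = 0.
Proof.
rewrite -[RHS](raddf0 (cls N)); apply/cls_eqP; rewrite subr0; apply/asboolP.
exists 0, X; rewrite add0r; split=> //.
exact: (rpred0 (submod_span (left_gen f J))).
Qed.

Lemma dv_cls_gen X P : left_gen f J P -> dv_cls (X * P) = 0.
Proof.
move=> JP; rewrite -[RHS](raddf0 (cls N)); apply/cls_eqP; rewrite subr0.
apply/asboolP; exists (X * P), 0; rewrite mulr0 addr0; split=> //.
apply: (rpredZ (s := submod_span (left_gen f J)) X (x := P)).
exact: submod_span_gen.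
Qed.

Lemma dv_cls_phiJ X Q : Q \in J -> dv_cls (X * phi f Q) = 0.
Proof. by move=> JQ; apply: dv_cls_gen; right; exists Q. Qed.

(** The difference of the two operators is a left multiple of (1 - fv) phi(P),
    which by graph_phi lies in the left ideal of 1 - fv. *)
Lemma dv_cls_fv q P :
  dv_cls (wpol (q * fv) * phi f P) = dv_cls (wpol q * phi f P).
Proof.
have [Y HY] := graph_phi f P.
have -> : wpol q * phi f P
    = wpol (q * fv) * phi f P + wpol q * Y * (1 - pol_incl f * wv K n).
  rewrite -mulrA; have -> : 1 - pol_incl f * wv K n = wpol (1 - fv).
    by rewrite rmorphB rmorphM rmorph1.
  rewrite -HY [wpol q * (_ * _)]mulrA -rmorphM -mulrDl -rmorphD.
  by congr (wpol _ * _); ring.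
by rewrite dv_clsD [X in _ + X]dv_cls_gen ?addr0 //; left.
Qed.

Lemma dv_cls_fvX k q P :
  dv_cls (wpol (q * fv ^+ k) * phi f P) = dv_cls (wpol q * phi f P).
Proof.
by elim: k => [|k IH]; rewrite ?expr0 ?mulr1 // exprSr mulrA dv_cls_fv.
Qed.

(** The lift of P (x) r/f^k; the factor f^2 compensates the f^-2 attached to the
    class of 1. *)
Definition frac_lift (r : R) (k : nat) (P : D) : dv_quotient f J :=
  dv_cls (wpol (mwiden (f ^+ 2 * r) * v ^+ k) * phi f P).

Lemma frac_liftDP r k P Q :
  frac_lift r k (P + Q) = frac_lift r k P + frac_lift r k Q.
Proof. by rewrite /frac_lift rmorphD mulrDr dv_clsD. Qed.

Lemma frac_liftDr r s k P :
  frac_lift (r + s) k P = frac_lift r k P + frac_lift s k P.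
Proof. by rewrite /frac_lift mulrDr mwidenD mulrDl rmorphD mulrDl dv_clsD. Qed.

Lemma frac_liftJ r k P Q : P - Q \in J -> frac_lift r k P = frac_lift r k Q.
Proof.
move=> JPQ; rewrite -[P](subrK Q) frac_liftDP -[RHS]add0r; congr (_ + _).
exact: dv_cls_phiJ.
Qed.

Lemma frac_lift_expand r k l P :
  frac_lift r k P = frac_lift (r * f ^+ l) (k + l) P.
Proof.
rewrite /frac_lift -(dv_cls_fvX l); congr (dv_cls (wpol _ * _)).
by rewrite !mwidenM !rmorphXn exprMn exprD; ring.
Qed.

(** Equality of fractions means equality of numerators after multiplication by a
    power of f, and enlarging both fractions by f^l costs only a factor (fv)^l,
    which acts as 1. *)
Lemma frac_lift_eq r k s l P :
  locfrac f r k = locfrac f s l -> frac_lift r k P = frac_lift s l P.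
Proof.
move=> /locfrac_eqP[m Hm].
(* Both sides get the denominator f^(k+l+m), where m absorbs the torsion in the
   equality of fractions. *)
rewrite (frac_lift_expand r k (l + m)) (frac_lift_expand s l (k + m)) addnCA.
congr frac_lift; apply/eqP; rewrite -subr_eq0; apply/eqP.
by rewrite -Hm !exprD; ring.
Qed.

Lemma frac_lift_pol r k s P :
  frac_lift r k (wpol s * P) = frac_lift (s * r) k P.
Proof.
have E : phi f (wpol s * P) = pol_incl s * phi f P.
  by rewrite -(phi_pol f s); exact: rmorphM.
rewrite /frac_lift E [wpol _ * (_ * _)]mulrA -rmorphM !mwidenM.
by congr (dv_cls (wpol _ * _)); ring.
Qed.

Local Notation M := (modquot J).
Local Notation L := (localized f M).
Local Notation MR := (restrict_scalars (@wpol K n) M).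
Local Notation Rf := (restrict_scalars (to_loc f) (loc f)^o).

Definition frac_pair (m : MR) (g : Rf) : dv_quotient f J :=
  frac_lift (repr (g : loc f)).1 (repr (g : loc f)).2 (repr (m : M)).

Lemma frac_pairE P r k : frac_pair (cls J P) (locfrac f r k) = frac_lift r k P.
Proof.
rewrite /frac_pair (frac_lift_eq _ (repr_locfrac f r k)).
by apply: frac_liftJ; apply/cls_eqP; exact: cls_repr.
Qed.

Lemma frac_pairDl m m' g :
  frac_pair (m + m') g = frac_pair m g + frac_pair m' g.
Proof.
rewrite -(cls_repr (m : M)) -(cls_repr (m' : M)).
elim/locfracW: (g : loc f) => r k.
transitivity (frac_pair (cls J (repr (m : M) + repr (m' : M))) (locfrac f r k)).
  by rewrite raddfD.
by rewrite !frac_pairE frac_liftDP.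
Qed.

Lemma frac_pairDr m g g' :
  frac_pair m (g + g') = frac_pair m g + frac_pair m g'.
Proof.
rewrite -(cls_repr (m : M)).
elim/locfracW: (g : loc f) => r k; elim/locfracW: (g' : loc f) => s l.
transitivity (frac_pair (cls J (repr (m : M)))
    (locfrac f (r * f ^+ l + s * f ^+ k) (k + l))).
  by rewrite -locfrac_add.
rewrite !frac_pairE frac_liftDr -(frac_lift_expand _ _ l); congr (_ + _).
by rewrite addnC -frac_lift_expand.
Qed.

Lemma frac_pairZ (a : R) m g : frac_pair (a *: m) g = frac_pair m (a *: g).
Proof.
rewrite -(cls_repr (m : M)); elim/locfracW: (g : loc f) => r k.
transitivity (frac_pair (cls J (wpol a * repr (m : M))) (locfrac f r k)).
  by congr frac_pair; exact: scale_clsE.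
transitivity (frac_pair (cls J (repr (m : M))) (locfrac f (a * r) k)).
  by rewrite !frac_pairE frac_lift_pol.
by congr frac_pair; rewrite -[k in LHS]add0n -locfrac_mul.
Qed.

Definition unlocalize : L -> dv_quotient f J := tensor_lift frac_pair.

Lemma unlocalize_lpure P r k :
  unlocalize (lpure (cls J P) (locfrac f r k)) = frac_lift r k P.
Proof.
rewrite -frac_pairE.
exact: (tensor_liftE frac_pairDl frac_pairDr frac_pairZ).
Qed.

Lemma unlocalize_additive : zmod_morphism unlocalize.
Proof. exact: (tensor_lift_additive frac_pairDl frac_pairDr frac_pairZ). Qed.

HB.instance Definition _ :=
  GRing.isZmodMorphism.Build L (dv_quotient f J) unlocalize unlocalize_additive.

(** D_v is seen here as a left D-module, so that the map extends linearly over D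
    to the quotient. *)
Definition integrate_fun (X : restrict_scalars (@weyl_incl K n) Dv^o) : L :=
  moment_act L (X : Dv) (pow_moments f (cls J 1)) 0%N.

Lemma integrate_fun_additive : zmod_morphism integrate_fun.
Proof. by move=> X Y; rewrite /integrate_fun rmorphB. Qed.

Lemma integrate_fun_scalable : scalable integrate_fun.
Proof.
move=> P X; rewrite /integrate_fun.
transitivity
  (moment_act L (weyl_incl P * (X : Dv)) (pow_moments f (cls J 1)) 0%N).
  by [].
by rewrite rmorphM /= moment_act_incl.
Qed.

HB.instance Definition _ := GRing.isZmodMorphism.Build
  (restrict_scalars (@weyl_incl K n) Dv^o) L integrate_fun integrate_fun_additive.
HB.instance Definition _ := GRing.isScalable.Build D
  (restrict_scalars (@weyl_incl K n) Dv^o) L *:%R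
  integrate_fun integrate_fun_scalable.

Lemma scale_cls1 P : P *: cls J 1 = cls J P.
Proof. by rewrite scale_clsE; congr (cls J _); exact: mulr1. Qed.

Lemma left_gen_moments P :
  left_gen f J P -> moment_act L (P : Dv) (pow_moments f (cls J 1)) = 0.
Proof.
case=> [->|[Q JQ ->]]; first exact: graph_moments.
rewrite phi_moments (_ : Q *: cls J 1 = 0).
  by apply: (addrI (pow_moments f 0)); rewrite -pow_momentsD !addr0.
by rewrite scale_cls1 -[RHS](raddf0 (cls J)); apply/cls_eqP; rewrite subr0.
Qed.

Lemma left_ideal_moments a : a \in submod_span (left_gen f J) ->
  moment_act L (a : Dv) (pow_moments f (cls J 1)) = 0.
Proof.
move=> /asboolP[s [Ss ->]]; rewrite big_seq.
elim/big_ind: _ => [|X Y HX HY|p /Ss Jp]; first by rewrite rmorph0.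
- transitivity (moment_act L (X : Dv) (pow_moments f (cls J 1))
    + moment_act L (Y : Dv) (pow_moments f (cls J 1))); first by rewrite rmorphD.
  by rewrite HX HY addr0.
- transitivity (moment_act L (p.1 : Dv)
    (moment_act L (p.2 : Dv) (pow_moments f (cls J 1)))).
    by rewrite rmorphM.
  by rewrite left_gen_moments // raddf0.
Qed.

Lemma integrate_fun_submod X : X \in N -> integrate_fun X = 0.
Proof.
move=> /asboolP[a [b [Ha ->]]].
transitivity (moment_act L (a : Dv) (pow_moments f (cls J 1)) 0%N
  + moment_act L (wdv K n * b) (pow_moments f (cls J 1)) 0%N).
  by rewrite /integrate_fun rmorphD.
rewrite left_ideal_moments // add0r rmorphM /= moment_act_wdv.
by rewrite /= oppr0.
Qed.

Definition integrate : {linear dv_quotient f J -> L} :=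
  quot_linear integrate_fun_submod.

Lemma integrate_pairing r k P :
  integrate (dv_cls (pol_incl r * wv K n ^+ k * phi f P))
  = lpure (cls J P) (locfrac f r k.+2).
Proof.
rewrite [LHS](quot_linear_cls integrate_fun_submod) [LHS]moment_pairing.
by rewrite scale_cls1.
Qed.

Lemma integrate_frac_lift r k P :
  integrate (frac_lift r k P) = lpure (cls J P) (locfrac f r k).
Proof.
rewrite /frac_lift; have -> : wpol (mwiden (f ^+ 2 * r) * v ^+ k) =
    pol_incl (f ^+ 2 * r) * wv K n ^+ k by rewrite rmorphM rmorphXn.
rewrite integrate_pairing; congr lpure; apply: locfrac_eq.
by rewrite mulrAC -exprD mulrC.
Qed.

Lemma unlocalizeK : cancel unlocalize integrate.
Proof.
apply: tensor_ind => [|t u Ht Hu|m g]; first by rewrite !raddf0.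
  transitivity (integrate (unlocalize t) - integrate (unlocalize u)).
    by rewrite -raddfB; congr (integrate _); exact: unlocalize_additive.
  by rewrite Ht Hu.
rewrite -(cls_repr (m : M)); elim/locfracW: (g : loc f) => r k.
by rewrite [unlocalize _]unlocalize_lpure integrate_frac_lift.
Qed.

(** By weyl_shear_ind it is enough to look at r v^k phi(Q), whose image under the
    composite is the class of (fv)^2 r v^k phi(Q). *)
Lemma integrateK : cancel integrate unlocalize.
Proof.
move=> q; rewrite -(cls_repr q); move: (repr q) => X {q}.
suff : unlocalize (integrate (dv_cls X)) = dv_cls X by [].
elim/(@weyl_shear_ind K n f): X => [r k Q|X|X Y HX HY].
- rewrite integrate_pairing unlocalize_lpure.
  have -> : pol_incl r * wv K n ^+ k = wpol (mwiden r * v ^+ k).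
    by rewrite rmorphM rmorphXn.
  rewrite -(dv_cls_fvX 2) /frac_lift; congr (dv_cls (wpol _ * _)).
  by rewrite mwidenM rmorphXn exprMn (exprD v 2 k : v ^+ k.+2 = _); ring.
- by rewrite dv_cls_wdv !raddf0.
- rewrite dv_clsD.
  transitivity
    (unlocalize (integrate (dv_cls X)) + unlocalize (integrate (dv_cls Y))).
    by rewrite !raddfD.
  by rewrite HX HY.
Qed.
End Inverse.

Theorem theorem2 (K : fieldType) (charK : [pchar K] =i pred0) (n : nat)
  (f : {mpoly K[n]}) (J : submodClosed (weyl K n)^o) :
  exists Phi : {linear dv_quotient f J -> localized f (modquot J)},
    [/\ bijective Phi,
        Phi (cls (dv_submod f J) 1) = lpure (cls J 1) (locfrac f 1 2)
      & loc_map f (cls J 1) = Phi (cls (dv_submod f J) (pol_incl f ^+ 2))].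
Proof.
exists (integrate f J); split.
- by exists (@unlocalize K n f J); [exact: integrateK | exact: unlocalizeK].
- by rewrite -(integrate_pairing f J 1 0 1) !rmorph1 expr0 !mulr1.
- have := integrate_pairing f J (f ^+ 2) 0 1.
  rewrite rmorphXn expr0 rmorph1 !mulr1 => ->; congr lpure.
  by apply: locfrac_eq; rewrite mul1r expr0 mulr1.
Qed.
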